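(* Let $$U(t):=\min\{N^*(t),N\},\qquad t\ge0,$$ where the random variable $N$ is independent of the process $N^*(t)$ and has distribution $\Pr(N=n)=q_n$, $n\in S$, and where $\Pr\{N^*(0)=r\}=1$. Let $u_{r,n}(t)=\Pr\{U(t)=n\}$ be the transition probabilities of $U(t)$ (note $U(0)=r$). Then $$u_{r,n}(t)=p_{r,n}(t)$$ for all $t\ge0$ and $n\in S$.
   Context: Let $r$ be a nonnegative integer, $S=\{r,r+1,r+2,\ldots\}$, and let $\alpha_n>0$ ($n\ge r$), $\beta_n\ge 0$ ($n\ge r+1$), $\xi>0$ be constants. $\{N(t);t\ge 0\}$ is the continuous-time Markov chain on $S$ (birth-death process with catastrophes) with transitions: $n\to n+1$ with rate $\alpha_n$ for $n\ge r$; $n\to n-1$ with rate $\beta_n$ for $n\ge r+2$; $r+1\to r$ with rate $\beta_{r+1}+\xi$; $n\to r$ with rate $\xi$ for $n\ge r+2$. Its transition probabilities are $p_{j,n}(t)=\Pr\{N(t)=n\mid N(0)=j\}$. The birth-death process $\widehat N(t)$ on $S$ with the same birth rates $\alpha_n$ and death rates $\beta_n$ but without catastrophes ($\xi$ replaced by $0$) is assumed non-explosive: $\sum_{n\ge r}\Pr\{\widehat N(t)=n\mid\widehat N(0)=j\}=1$ for all $j\in S$, $t\ge0$. $N(t)$ has a steady-state distribution $q_n=\lim_{t\to+\infty}p_{j,n}(t)$, $n\in S$ (independent of $j$, with $\sum_{n\ge r}q_n=1$). $\{N^*(t);t\ge0\}$ is the time-homogeneous birth-death process on $S$, with $r$ a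 reflecting state, having birth and death rates $$\alpha_n^*=\alpha_n\,\frac{\sum_{k=n}^{+\infty}q_k}{\sum_{k=n+1}^{+\infty}q_k}\quad(n\ge r),\qquad \beta_n^*=\beta_n\,\frac{\sum_{k=n+1}^{+\infty}q_k}{\sum_{k=n}^{+\infty}q_k}\quad(n>r).$$ *)

(* Defs.v *)
From HB Require Import structures.
From mathcomp Require Import all_boot all_order all_algebra.
From mathcomp Require Import all_classical all_reals all_analysis.
Set Implicit Arguments.
Unset Strict Implicit.
Unset Printing Implicit Defensive.
Import Order.TTheory GRing.Theory Num.Theory.
Import numFieldNormedType.Exports.
Local Open Scope classical_set_scope.
Local Open Scope ring_scope.

(* The state space S = {r, r+1, ...} is encoded by the naturals n with r <= n;
   [p j n t] stands for p_{j,n}(t), and only its values at j, n in S and t >= 0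
   are ever constrained. *)

(* Substochastic: the missing mass 1 - \sum_n p_{j,n}(t) is the probability of
   having exploded by time t. *)
Record transition_function (R : realType) (r : nat)
    (p : nat -> nat -> R -> R) : Prop := {
  tf_ge0 : forall j n t, (r <= j)%N -> (r <= n)%N -> 0 <= t -> 0 <= p j n t ;
  tf_sum_le1 : forall j t, (r <= j)%N -> 0 <= t ->
    (\sum_(r <= n <oo) (p j n t)%:E <= 1)%E ;
  tf_init : forall j n, (r <= j)%N -> (r <= n)%N -> p j n 0 = (j == n)%:R ;
  tf_chapman_kolmogorov : forall j n s t,
    (r <= j)%N -> (r <= n)%N -> 0 <= s -> 0 <= t ->
    (\sum_(r <= k <oo) (p j k s * p k n t)%:E)%E = (p j n (s + t))%:E }.

(* [q j n], j != n, is the rate of the transition j -> n; the diagonal of [q]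
   is irrelevant, the rate out of j being the sum of the rates j -> n. *)
Definition has_rates (R : realType) (r : nat) (q : nat -> nat -> R)
    (p : nat -> nat -> R -> R) : Prop :=
  (forall j n, (r <= j)%N -> (r <= n)%N -> j != n ->
     p j n h / h @[h --> 0^'+] --> q j n) /\
  (forall j, (r <= j)%N ->
     ((1 - p j j h) / h)%:E @[h --> 0^'+] -->
       (\sum_(r <= n <oo | n != j) (q j n)%:E)%E).

(* Transition function of *the* Markov chain with rates [q]: when the rates are
   explosive they do not determine the transition function, and the chain is by
   convention the minimal one, i.e. the one killed at explosion. *)
Definition chain_transitions (R : realType) (r : nat) (q : nat -> nat -> R)
    (p : nat -> nat -> R -> R) : Prop :=
  [/\ transition_function r p, has_rates r q p &
    forall p', transition_function r p' -> has_rates r q p' ->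
      forall j n t, (r <= j)%N -> (r <= n)%N -> 0 <= t -> p j n t <= p' j n t].

Definition catastrophe_rate (R : realType) (r : nat) (alpha beta : nat -> R)
    (xi : R) (n m : nat) : R :=
  if m == n.+1 then alpha n
  else if (n == r.+1) && (m == r) then beta r.+1 + xi
  else if (r.+2 <= n)%N && (m == n.-1) then beta n
  else if (r.+2 <= n)%N && (m == r) then xi
  else 0.

Definition birth_death_rate (R : realType) (r : nat) (alpha beta : nat -> R) :
    nat -> nat -> R :=
  catastrophe_rate r alpha beta 0.

Definition tail (R : realType) (q : nat -> R) (n : nat) : R :=
  \big[+%R/0]_(n <= k <oo) q k.

Definition alpha_star (R : realType) (alpha q : nat -> R) (n : nat) : R :=
  alpha n * (tail q n / tail q n.+1).

Definition beta_star (R : realType) (beta q : nat -> R) (n : nat) : R :=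
  beta n * (tail q n.+1 / tail q n).

(* Processes take values in option nat, None being the point at infinity that
   is reached at explosion. *)

Definition path_event (R : realType) (T : Type) (X : R -> T -> option nat)
    (s : seq (R * option nat)) : set T :=
  [set w | forall e, e \in s -> X e.1 w = e.2].

(* The Markov property is stated without dividing by the probability of the
   conditioning event. *)
Record markov_chain (R : realType) (d : measure_display)
    (T : measurableType d) (P : probability T R) (r : nat)
    (X : R -> T -> option nat) (p : nat -> nat -> R -> R) : Prop := {
  mc_measurable : forall t x, 0 <= t -> measurable [set w | X t w = x] ;
  mc_state : forall t w k, 0 <= t -> X t w = Some k -> (r <= k)%N ;
  mc_markov : forall (s : seq (R * option nat)) j n t u,
    (forall e, e \in s -> 0 <= e.1 <= t) ->
    (r <= j)%N -> (r <= n)%N -> 0 <= t -> 0 <= u ->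
    P (path_event X s `&` [set w | X t w = Some j]
         `&` [set w | X (t + u) w = Some n]) =
    (P (path_event X s `&` [set w | X t w = Some j]) * (p j n u)%:E)%E }.

Definition independent_of_process (R : realType) (d : measure_display)
    (T : measurableType d) (P : probability T R)
    (X : R -> T -> option nat) (N : T -> nat) : Prop :=
  forall (s : seq (R * option nat)) n, (forall e, e \in s -> 0 <= e.1) ->
    P (path_event X s `&` [set w | N w = n]) =
    (P (path_event X s) * P [set w | N w = n])%E.

Definition min_infty (x : option nat) (m : nat) : nat :=
  if x is Some k then minn k m else m.

(* Main.v *)
Require Import Defs.
From HB Require Import structures.
From mathcomp Require Import all_boot all_order all_algebra.
From mathcomp Require Import all_classical all_reals all_analysis.
From mathcomp Require Import ring lra zify.
Import Order.TTheory GRing.Theory Num.Theory.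
Import numFieldNormedType.Exports.
Local Open Scope classical_set_scope.
Local Open Scope ring_scope.
Set Implicit Arguments.
Unset Strict Implicit.
Unset Printing Implicit Defensive.

(* Write Q_n, F_n(t) and G_n(t) for the tails of q, of p_{r,.}(t) and of
   p*_{r,.}(t) (the last one including the exploded mass). By independence,
   Pr(U(t) >= n) = Q_n G_n(t), so the claim is Q_n G_n = F_n. The forward
   equations are
     F_n' = alpha_(n-1) (F_(n-1) - F_n) - beta_n (F_n - F_(n+1)) - xi F_n,
   whose stationary case holds for Q, and the same for G with the starred rates
   and without the last term; the starred rates are precisely those for which
   Q_n G_n solves the equations of F_n. Since N* may explode, the infinite
   systems need not have unique solutions, and one compares instead the chains
   killed on leaving a window [r, M): by a maximum principle,
   |Q_n G_n - F_n| <= Q_M + (mass lost by N before t), and both terms tend to 0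
   as M grows. That a minimal transition function is the limit of these killed
   chains follows by checking that the limit is itself a transition function
   with the given rates, and that it lies below every other one. *)

(** * Calculus *)

Lemma cvg_sum_nat (R : realType) (T : Type) (F : set_system T) (FF : Filter F)
    (m n : nat) (f : nat -> T -> R) (a : nat -> R) :
  (forall i, (m <= i < n)%N -> f i x @[x --> F] --> a i) ->
  \sum_(m <= i < n) f i x @[x --> F] --> \sum_(m <= i < n) a i.
Proof.
move=> fa; rewrite big_nat_cond; under eq_fun do rewrite big_nat_cond.
by apply: cvg_big => [|i /andP[/fa]//]; exact: add_continuous.
Qed.

Lemma is_derive_sum_nat (R : realType) (m n : nat) (h dh : nat -> R -> R)
    (t : R) :
  (forall i, (m <= i < n)%N -> is_derive t 1 (h i) (dh i t)) ->
  is_derive t 1 (fun t => \sum_(m <= i < n) h i t) (\sum_(m <= i < n) dh i t).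
Proof.
elim: n => [|n IHn] hdh.
  rewrite big_geq//; under eq_fun do rewrite big_geq//.
  exact: is_derive_cst.
have [mn|nm] := leqP m n; last first.
  rewrite big_geq//; under eq_fun do rewrite big_geq//.
  exact: is_derive_cst.
rewrite big_nat_recr//=; under eq_fun do rewrite big_nat_recr//=.
apply: is_deriveD; last by apply: hdh; rewrite mn ltnSn.
by apply: IHn => i /andP[mi im]; apply: hdh; rewrite mi ltnW.
Qed.

Lemma is_derive_cts (R : realType) (f : R -> R) (t l : R) :
  is_derive t 1 f l -> {for t, continuous f}.
Proof. by move=> [/derivable1_diffP/differentiable_continuous]. Qed.

Lemma is_derive_ndecr (R : realType) (f df : R -> R) (a b : R) :
  (forall t : R, is_derive t 1 f (df t)) ->
  (forall t, a <= t <= b -> 0 <= df t) -> a <= b -> f a <= f b.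
Proof.
move=> fdf df0; rewrite le_eqVlt => /predU1P[->//|ab].
have [|c cab] := @MVT _ f df _ _ ab (fun x _ => fdf x).
  by apply: continuous_subspaceT => x; exact: is_derive_cts (fdf x).
move=> fba; rewrite -subr_ge0 fba; apply: mulr_ge0; last first.
  by rewrite subr_ge0 ltW.
by apply: df0; move: cab; rewrite in_itv/= => /andP[/ltW-> /ltW->].
Qed.

Lemma is_derive_0_eq (R : realType) (f : R -> R) (a b : R) :
  (forall t : R, is_derive t 1 f 0) -> a <= b -> f a = f b.
Proof.
move=> f0 ab; apply/eqP; rewrite eq_le; apply/andP; split.
  exact: (@is_derive_ndecr _ f (cst 0)).
rewrite -lerN2; apply: (@is_derive_ndecr _ (fun t => - f t) (cst 0)) => // t.
by apply: is_derive_eq; rewrite oppr0.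
Qed.

Lemma is_derive_expZ (R : realType) (c t : R) :
  is_derive t 1 (fun t => expR (c * t)) (c * expR (c * t)).
Proof.
apply: (@is_derive_eq _ _ _ _ _ _ _ _ (is_derive1_comp _ _)).
by rewrite /= mulrC scaler1 mulrC.
Qed.

Lemma is_derive_addl (R : realType) (f : R -> R) (s t l : R) :
  is_derive (s + t) 1 f l -> is_derive t 1 (fun t => f (s + t)) l.
Proof.
move=> fl; rewrite -[l]mulr1; apply: (@is_derive1_comp _ f (fun t => s + t)).
by apply: is_derive_eq; rewrite add0r mulr1.
Qed.

Lemma is_derive_subr (R : realType) (f : R -> R) (s t l : R) :
  is_derive (s - t) 1 f l -> is_derive t 1 (fun t => f (s - t)) (- l).
Proof.
move=> fl; rewrite -mulrN1; apply: (@is_derive1_comp _ f (fun t => s - t)).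
by apply: is_derive_eq; rewrite add0r mul1r.
Qed.

(** * The semigroup of a finite generator *)

Lemma sum_nat_deltal (R : realType) (m n i : nat) (g : nat -> R) :
  (m <= i < n)%N -> \sum_(m <= l < n) (i == l)%:R * g l = g i.
Proof.
move=> imn; transitivity (\sum_(m <= l < n | l == i) g l).
  rewrite [RHS]big_mkcond/=; apply: eq_bigr => l _.
  by rewrite eq_sym; case: (l == i); rewrite ?mul1r ?mul0r.
by rewrite big_nat1_eq imn.
Qed.

Lemma sum_nat_deltar (R : realType) (m n j : nat) (g : nat -> R) :
  (m <= j < n)%N -> \sum_(m <= l < n) g l * (l == j)%:R = g j.
Proof.
move=> jmn; rewrite -[RHS](sum_nat_deltal _ jmn); apply: eq_bigr => l _.
by rewrite mulrC eq_sym.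
Qed.

Section window_semigroup.
Variables (R : realType) (r M : nat) (Q : nat -> nat -> R).

(** Any constant dominating all the |Q i i| would do; the sum is one that avoids taking a
    maximum. *)
Definition uniform_rate : R := \sum_(r <= i < M) `|Q i i|.

Definition jump_matrix (i j : nat) : R := Q i j + uniform_rate * (i == j)%:R.

Fixpoint jump_power (k i j : nat) : R :=
  if k is k'.+1 then \sum_(r <= l < M) jump_power k' i l * jump_matrix l j
  else (i == j)%:R.

Definition jump_coef (i j k : nat) : R := jump_power k i j / k`!%:R.

(* Uniformization: [exp (t Q) = e^(-ct) exp (t K)] with [K = Q + c], which has
   nonnegative entries. *)
Definition window_semigroup (i j : nat) (t : R) : R :=
  expR (- uniform_rate * t) * limn (pseries (jump_coef i j) t).

Local Notation c := uniform_rate.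
Local Notation K := jump_matrix.
Local Notation f := window_semigroup.

(** [jump_power] multiplies by K on the right, which leads to the forward equation; splitting K off
    on the left is what the backward equation needs. *)
Lemma jump_powerSl k i j : (r <= i < M)%N -> (r <= j < M)%N ->
  jump_power k.+1 i j = \sum_(r <= l < M) K i l * jump_power k l j.
Proof.
move=> iM; elim: k j => [|k IHk] j jM.
  by rewrite /= sum_nat_deltal// sum_nat_deltar.
rewrite [LHS]/=; under eq_big_nat => l lM do
  rewrite -/(jump_power k.+1 i l) IHk// mulr_suml.
rewrite exchange_big/=; apply: eq_bigr => l _.
by rewrite mulr_sumr; apply: eq_bigr => m _; rewrite mulrA.
Qed.

(** A crude bound that dominates every column sum of |K|, so that the entries of K^k are at most B^k
    and [jump_coef] is dominated by the coefficients of exp(B t). *)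
Let B : R := \sum_(r <= j < M) \sum_(r <= l < M) `|K l j|.

Let B_ge0 : 0 <= B. Proof. by do 2 (apply: sumr_ge0 => ? _). Qed.

Let jump_power_le k i j : (r <= j < M)%N -> `|jump_power k i j| <= B ^+ k.
Proof.
elim: k j => [|k IHk] j jM.
  by rewrite /= expr0; case: eqP; rewrite ?normr1 ?normr0.
rewrite /= (le_trans (ler_norm_sum _ _ _))//.
apply: (@le_trans _ _ (\sum_(r <= l < M) B ^+ k * `|K l j|)).
  by apply: ler_sum_nat => l lM; rewrite normrM ler_wpM2r// IHk.
rewrite -mulr_sumr exprSr ler_wpM2l ?exprn_ge0//.
rewrite /B [leRHS](big_cat_nat (n := j))/=; [|lia..].
rewrite [X in _ <= _ + X]big_ltn; last lia.
rewrite addrCA lerDl addr_ge0//; by do 2 (apply: sumr_ge0 => ? _).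
Qed.

Let jump_coef_cvg i j t : (r <= j < M)%N -> cvgn (pseries (jump_coef i j) t).
Proof.
move=> jM; apply: normed_cvg; rewrite /=.
apply: (@series_le_cvg _ _ (exp_coeff (B * `|t|))).
- by move=> n /=.
- by move=> n; rewrite /exp_coeff/= divr_ge0// exprn_ge0// mulr_ge0.
- move=> n; rewrite /exp_coeff/= /jump_coef !normrM normfV normrX exprMn.
  rewrite (ger0_norm (ler0n _ _)) mulrAC ler_wpM2r ?invr_ge0//.
  by rewrite ler_wpM2r ?exprn_ge0// jump_power_le.
- exact: is_cvg_series_exp_coeff.
Qed.

Let pseries_diffs_jump i j :
  pseries_diffs (jump_coef i j) =
  (fun k => \sum_(r <= l < M) jump_coef i l k * K l j).
Proof.
apply/funext => k; rewrite /pseries_diffs /jump_coef factS natrM invfM/=.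
rewrite mulrCA mulVKf ?pnatr_eq0// mulr_suml.
by apply: eq_bigr => l _; rewrite mulrAC.
Qed.

Let pseries_diffs_jumpl i j : (r <= i < M)%N -> (r <= j < M)%N ->
  pseries_diffs (jump_coef i j) =
  (fun k => \sum_(r <= l < M) jump_coef l j k * K i l).
Proof.
move=> iM jM; apply/funext => k.
rewrite /pseries_diffs /jump_coef factS natrM invfM jump_powerSl//.
rewrite mulrCA mulVKf ?pnatr_eq0// mulr_suml.
by apply: eq_bigr => l _; rewrite [RHS]mulrC mulrA.
Qed.

Let pseries_sum_cvg (g : nat -> nat -> R) (h : nat -> R) t :
  (forall l, (r <= l < M)%N -> cvgn (pseries (g l) t)) ->
  pseries (fun k => \sum_(r <= l < M) g l k * h l) t @ \oo -->
  \sum_(r <= l < M) limn (pseries (g l) t) * h l.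
Proof.
move=> gt; rewrite (_ : pseries _ t =
    fun n => \sum_(r <= l < M) pseries (g l) t n * h l); last first.
  apply/funext => n; rewrite /pseries /series/=.
  under [RHS]eq_bigr do rewrite mulr_suml.
  rewrite exchange_big/=; apply: eq_bigr => k _.
  by rewrite mulr_suml; apply: eq_bigr => l _; rewrite mulrAC.
by apply: cvg_sum_nat => l lM; apply: cvgMr_tmp; exact: gt.
Qed.

Let jump_exp i j t : R := limn (pseries (jump_coef i j) t).

Let jump_diffs_cvg i j t : (r <= i < M)%N -> (r <= j < M)%N ->
  pseries (pseries_diffs (jump_coef i j)) t @ \oo -->
    \sum_(r <= l < M) jump_exp i l t * K l j.
Proof.
move=> iM jM; rewrite pseries_diffs_jump.
by apply: pseries_sum_cvg => l lM; exact: jump_coef_cvg.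
Qed.

(** exp(tK) commutes with K: both sides are the sum of the differentiated series, whose coefficients
    K^(k+1)/k! can be factored on either side. *)
Let jump_exp_comm i j t : (r <= i < M)%N -> (r <= j < M)%N ->
  \sum_(r <= l < M) jump_exp i l t * K l j =
  \sum_(r <= l < M) jump_exp l j t * K i l.
Proof.
move=> iM jM; have /cvg_lim <-// := @jump_diffs_cvg _ _ t iM jM.
apply: cvg_lim => //; rewrite pseries_diffs_jumpl//.
by apply: pseries_sum_cvg => l lM; exact: jump_coef_cvg.
Qed.

(** Termwise differentiation at t asks for convergence of the series and of its first two formal
    derivatives at a point beyond |t|; |t| + 1 is taken. *)
Let jump_exp_is_derive i j (t : R) : (r <= i < M)%N -> (r <= j < M)%N ->
  is_derive t 1 (jump_exp i j) (\sum_(r <= l < M) jump_exp i l t * K l j).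
Proof.
move=> iM jM; have /cvg_lim <-// := @jump_diffs_cvg _ _ t iM jM.
apply: (@pseries_snd_diffs _ _ (`|t| + 1)).
- exact: jump_coef_cvg.
- by apply/cvg_ex; eexists; exact: jump_diffs_cvg.
- rewrite pseries_diffs_jump.
  rewrite (_ : pseries_diffs _ = (fun k => \sum_(r <= l < M)
      pseries_diffs (jump_coef i l) k * K l j)); last first.
    apply/funext => k; rewrite {1}/pseries_diffs mulr_sumr.
    by apply: eq_bigr => l _; rewrite mulrA.
  apply/cvg_ex; eexists; apply: pseries_sum_cvg => l lM.
  by apply/cvg_ex; eexists; exact: jump_diffs_cvg.
- by rewrite [ltRHS]ger0_norm ?ltrDl// addr_ge0.
Qed.

Lemma window_semigroup_forward i j (t : R) :
  (r <= i < M)%N -> (r <= j < M)%N ->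
  is_derive t 1 (f i j) (\sum_(r <= l < M) f i l t * Q l j).
Proof.
move=> iM jM.
apply: (is_derive_eq
  (is_deriveM (is_derive_expZ (- c) t) (jump_exp_is_derive t iM jM))).
rewrite /GRing.scale/=.
transitivity (\sum_(r <= l < M) (expR (- c * t) * jump_exp i l t) * K l j
    - c * (expR (- c * t) * jump_exp i j t)).
  congr (_ + _); last by ring.
  by rewrite mulr_sumr; apply: eq_bigr => l _; rewrite mulrA.
(* The diagonal shift c in K = Q + c cancels the derivative of the factor exp(-ct). *)
under [X in X - _]eq_bigr do rewrite /jump_matrix mulrDr [X in _ + X]mulrA.
rewrite big_split/= sum_nat_deltar// [X in _ + X - _]mulrC addrK.
by [].
Qed.

Lemma window_semigroup_backward i j (t : R) :
  (r <= i < M)%N -> (r <= j < M)%N ->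
  is_derive t 1 (f i j) (\sum_(r <= l < M) Q i l * f l j t).
Proof.
move=> iM jM; apply: (is_derive_eq (window_semigroup_forward t iM jM)).
have := @jump_exp_comm _ _ t iM jM.
under eq_bigr do rewrite /jump_matrix mulrDr mulrA.
under [RHS]eq_bigr do rewrite /jump_matrix mulrDr [_ * (c * _)]mulrCA mulrA.
rewrite !big_split/= sum_nat_deltar//.
under [X in _ = _ + X]eq_bigr do rewrite mulrC.
rewrite sum_nat_deltal// [X in _ + X = _]mulrC => /addIr E.
rewrite /f; under eq_bigr do rewrite -mulrA.
rewrite -mulr_sumr [X in _ * X]E mulr_sumr; apply: eq_bigr => l _.
by rewrite mulrA mulrC.
Qed.

Lemma window_semigroup0 i j : f i j 0 = (i == j)%:R.
Proof.
rewrite /f mulr0 expR0 mul1r; apply: lim_near_cst => //.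
near=> n; rewrite /pseries/series/= big_ltn; last by near: n; exists 1%N.
rewrite expr0 mulr1 big_nat_cond big1 ?addr0.
  by rewrite /jump_coef/= fact0 divr1.
by move=> [|k]// _; rewrite expr0n mulr0.
Unshelve. all: by end_near. Qed.

Lemma window_semigroupD i j s t : (r <= i < M)%N -> (r <= j < M)%N ->
  0 <= t -> f i j (s + t) = \sum_(r <= l < M) f i l s * f l j t.
Proof.
move=> iM jM t0.
(* [g] interpolates between the two sides, at u = t and u = 0; the forward equation for the first
   factor and the backward one for the second make its derivative vanish. *)
pose g u := \sum_(r <= l < M) f i l (s + u) * f l j (t - u).
transitivity (g t).
  rewrite /g subrr; under eq_bigr do rewrite window_semigroup0.
  by rewrite sum_nat_deltar.
suff g0 (u : R) : is_derive u 1 g 0.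
  by rewrite -(is_derive_0_eq g0 t0) /g addr0 subr0.
have dg : is_derive u 1 g (\sum_(r <= l < M)
    (f i l (s + u) * - (\sum_(r <= m < M) Q l m * f m j (t - u)) +
     f l j (t - u) * (\sum_(r <= m < M) f i m (s + u) * Q m l))).
  apply: (@is_derive_sum_nat _ r M (fun l u => f i l (s + u) * f l j (t - u))
    (fun l u => f i l (s + u) * - (\sum_(r <= m < M) Q l m * f m j (t - u)) +
     f l j (t - u) * (\sum_(r <= m < M) f i m (s + u) * Q m l))) => l lM.
  exact: (is_deriveM (is_derive_addl (window_semigroup_forward _ iM lM))
    (is_derive_subr (window_semigroup_backward _ lM jM))).
apply: (is_derive_eq dg); rewrite big_split/=; apply/eqP.
under eq_bigr do rewrite mulrN mulr_sumr.
rewrite sumrN addrC subr_eq0; apply/eqP.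
under eq_bigr do rewrite mulr_sumr.
rewrite exchange_big/=; apply: eq_bigr => l _; apply: eq_bigr => m _.
by rewrite mulrC -mulrA.
Qed.

Section nonneg.
Hypothesis Q_ge0 : forall i j, (r <= i < M)%N -> (r <= j < M)%N -> i != j ->
  0 <= Q i j.

Let jump_power_ge0 k i j : (r <= j < M)%N -> 0 <= jump_power k i j.
Proof.
elim: k j => [|k IHk] j jM; first by rewrite /= ler0n.
rewrite /= big_nat_cond; apply: sumr_ge0 => l; rewrite andbT => lM.
rewrite mulr_ge0 ?IHk// /jump_matrix; have [<-|lj] := eqVneq l j; last first.
  by rewrite mulr0 addr0 Q_ge0.
(* On the diagonal, nonnegativity is due to the shift: |Q l l| is one of the terms of c. *)
suff : `|Q l l| <= c by have := ler_norm (- Q l l); rewrite normrN mulr1; lra.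
rewrite /c [leRHS](big_cat_nat (n := l))/=; [|lia..].
rewrite [X in _ <= _ + X]big_ltn; last lia.
by rewrite addrCA lerDl addr_ge0// sumr_ge0.
Qed.

Lemma window_semigroup_ge0 i j t : (r <= j < M)%N -> 0 <= t -> 0 <= f i j t.
Proof.
move=> jM t0; rewrite /f mulr_ge0 ?expR_ge0//.
apply: limr_ge; first exact: jump_coef_cvg.
apply: nearW => n; rewrite /pseries/series/=; apply: sumr_ge0 => k _.
by rewrite mulr_ge0 ?exprn_ge0// divr_ge0// jump_power_ge0.
Qed.

Hypothesis Q_le0 : forall i, (r <= i < M)%N -> \sum_(r <= j < M) Q i j <= 0.

(** By the forward equation the mass has derivative sum_l f_il (sum_j Q_lj), and the row sums of Q
    are nonpositive. *)
Lemma window_semigroup_mass_nincr i s t : (r <= i < M)%N -> 0 <= s -> s <= t ->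
  \sum_(r <= j < M) f i j t <= \sum_(r <= j < M) f i j s.
Proof.
move=> iM s0 st.
pose dS u := \sum_(r <= j < M) \sum_(r <= l < M) f i l u * Q l j.
rewrite -lerN2.
apply: (@is_derive_ndecr _ (fun u => - \sum_(r <= j < M) f i j u)
  (fun u => - dS u)) => // [u|u /andP[su _]].
  apply: is_deriveN; apply: (@is_derive_sum_nat _ r M (fun j => f i j)
    (fun j u => \sum_(r <= l < M) f i l u * Q l j)) => j jM.
  exact: window_semigroup_forward.
rewrite oppr_ge0 /dS exchange_big/=.
rewrite big_nat_cond; apply: sumr_le0 => l; rewrite andbT => lM.
rewrite -mulr_sumr mulr_ge0_le0 ?Q_le0// window_semigroup_ge0//.
exact: le_trans su.
Qed.

Lemma window_semigroup_mass_le1 i t : (r <= i < M)%N -> 0 <= t ->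
  \sum_(r <= j < M) f i j t <= 1.
Proof.
move=> iM t0; rewrite (le_trans (window_semigroup_mass_nincr iM (lexx 0) t0))//.
rewrite -[leRHS](@sum_nat_deltal R r M i (fun=> 1))//.
by apply: ler_sum => j _; rewrite window_semigroup0 mulr1.
Qed.

Lemma window_semigroup_le1 i j t : (r <= i < M)%N -> (r <= j < M)%N -> 0 <= t ->
  f i j t <= 1.
Proof.
move=> iM jM t0; apply: le_trans (window_semigroup_mass_le1 iM t0).
rewrite (bigD1_seq j) ?mem_index_iota ?iota_uniq//= lerDl big_nat_cond.
by apply: sumr_ge0 => l /andP[lM _]; exact: window_semigroup_ge0.
Qed.

End nonneg.
End window_semigroup.

Lemma is_derive_at_right (R : realType) (f : R -> R) (l : R) :
  is_derive (0 : R) 1 f l -> (f h - f 0) / h @[h --> 0^'+] --> l.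
Proof.
move=> [df <-]; apply: cvg_dnbhs_at_right.
move: df => /cvg_ex[/= k dfk]; rewrite /derive (cvg_lim _ dfk)//.
apply: cvg_trans dfk; apply: near_eq_cvg; near=> h.
by rewrite /= [h *: _]mulr1 addr0 /GRing.scale/= mulrC.
Unshelve. all: by end_near. Qed.

Lemma at_right_ex (R : realType) (P : set R) :
  (\forall h \near 0^'+, P h) ->
  exists2 d : R, 0 < d & forall h, 0 < h -> h < d -> P h.
Proof.
move=> /nbhs_ballP[d /= d0 dP]; exists d => // h h0 hd.
by apply: (dP h) => //; rewrite /ball/= sub0r normrN gtr0_norm.
Qed.

(** * Comparison with supermultiplicative families *)

Section comparison.
Variables (R : realType) (r M : nat) (Q : nat -> nat -> R).
Hypothesis Q_ge0 : forall i j, (r <= i < M)%N -> (r <= j < M)%N -> i != j ->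
  0 <= Q i j.
Hypothesis Q_le0 : forall i, (r <= i < M)%N -> \sum_(r <= j < M) Q i j <= 0.
Local Notation f := (window_semigroup r M Q).

Lemma window_semigroup_rate i j : (r <= i < M)%N -> (r <= j < M)%N ->
  (f i j h - (i == j)%:R) / h @[h --> 0^'+] --> Q i j.
Proof.
move=> iM jM; rewrite -(window_semigroup0 r M Q); apply: is_derive_at_right.
apply: (is_derive_eq (window_semigroup_forward Q 0 iM jM)).
under eq_bigr do rewrite window_semigroup0.
by rewrite sum_nat_deltal.
Qed.

(** Write f(t) as the m-th power of f(h) with h = t/m, and replace the factors f(h) by A(h) one at a
    time. Each replacement costs at most [E h] = o(h), since both families have derivative Q at 0,
    so the total cost m E(t/m) tends to 0; supermultiplicativity collects the factors A(h) into
    A(t). *)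
Lemma window_semigroup_le (A : nat -> nat -> R -> R) :
  (forall i j t, (r <= i < M)%N -> (r <= j < M)%N -> 0 <= t ->
    0 <= A i j t <= 1) ->
  (forall i j, (r <= i < M)%N -> (r <= j < M)%N -> A i j 0 = (i == j)%:R) ->
  (forall i j s t, (r <= i < M)%N -> (r <= j < M)%N -> 0 <= s -> 0 <= t ->
    \sum_(r <= l < M) A i l s * A l j t <= A i j (s + t)) ->
  (forall i j, (r <= i < M)%N -> (r <= j < M)%N ->
    (A i j h - (i == j)%:R) / h @[h --> 0^'+] --> Q i j) ->
  forall i j t, (r <= i < M)%N -> (r <= j < M)%N -> 0 <= t ->
    f i j t <= A i j t.
Proof.
move=> A01 A0 AM AQ i j t iM jM; rewrite le_eqVlt => /predU1P[<-|t0].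
  by rewrite window_semigroup0 A0.
pose E (h : R) := \sum_(r <= k < M) \sum_(r <= l < M) `|f k l h - A k l h|.
(* State after m replacements: m steps of length h are made with A, the remaining n with f. *)
have stepE m n (h : R) : 0 <= h -> f i j ((m + n)%:R * h) <=
    \sum_(r <= k < M) A i k (m%:R * h) * f k j (n%:R * h) + m%:R * E h.
  move=> h0; elim: m n => [|m IHm] n.
    rewrite !mul0r addr0.
    under eq_big_nat => k kM do rewrite A0//.
    by rewrite sum_nat_deltal.
  have -> : (m.+1 + n = m + n.+1)%N by lia.
  apply: (le_trans (IHm n.+1)); rewrite -[m.+1]addn1 natrD !mulrDl !mul1r.
  rewrite [m%:R * E h + _]addrC addrA lerD2r.
  have -> : n.+1%:R * h = h + n%:R * h by rewrite -nat1r mulrDl mul1r.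
  apply: (@le_trans _ _ (\sum_(r <= k < M) A i k (m%:R * h) *
      (\sum_(r <= l < M) A k l h * f l j (n%:R * h)) + E h)).
    rewrite /E -big_split/= ler_sum_nat// => k kM.
    rewrite window_semigroupD// ?mulr_ge0// -lerBlDl -mulrBr -sumrB.
    have /andP[Ak0 Ak1] : 0 <= A i k (m%:R * h) <= 1.
      by apply: A01 => //; rewrite mulr_ge0.
    have [S0|S0] := leP 0 (\sum_(r <= l < M)
        (f k l h * f l j (n%:R * h) - A k l h * f l j (n%:R * h))); last first.
      apply: (@le_trans _ _ 0); last exact: sumr_ge0.
      by rewrite mulr_ge0_le0// ltW.
    apply: (le_trans (ler_piMl S0 Ak1)); apply: ler_sum_nat => l lM.
    rewrite -mulrBl (le_trans (ler_norm _))// normrM ler_piMr//.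
    rewrite ger0_norm.
      by apply: window_semigroup_le1 => //; rewrite mulr_ge0.
    by apply: window_semigroup_ge0 => //; rewrite mulr_ge0.
  rewrite lerD2r; under eq_bigr do rewrite mulr_sumr.
  rewrite exchange_big/= ler_sum_nat// => l lM.
  under eq_bigr do rewrite mulrA.
  rewrite -mulr_suml ler_wpM2r//; last by apply: AM => //; rewrite mulr_ge0.
  by apply: window_semigroup_ge0 => //; rewrite mulr_ge0.
have E0 : E h / h @[h --> 0^'+] --> (0 : R).
  have QQ0 : \sum_(r <= k < M) \sum_(r <= l < M) `|Q k l - Q k l| = 0.
    by rewrite big1// => k _; rewrite big1// => l _; rewrite subrr normr0.
  have cvE : (fun h => \sum_(r <= k < M) \sum_(r <= l < M)
      `|(f k l h - (k == l)%:R) / h - (A k l h - (k == l)%:R) / h|) @ 0^'+ -->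
      \sum_(r <= k < M) \sum_(r <= l < M) `|Q k l - Q k l|.
    apply: cvg_sum_nat => k kM; apply: cvg_sum_nat => l lM.
    apply: cvg_norm; apply: cvgB; last exact: AQ.
    exact: window_semigroup_rate.
  rewrite QQ0 in cvE; apply: cvg_trans cvE; apply: near_eq_cvg; near=> h.
  rewrite /E mulr_suml; apply: eq_bigr => k _.
  rewrite mulr_suml; apply: eq_bigr => l _.
  rewrite -mulrBl opprB addrA subrK normrM; congr (_ * _).
  by rewrite gtr0_norm// invr_gt0.
apply/ler_addgt0Pr => e e0.
have /at_right_ex [d d0 dE] : \forall h \near 0^'+, E h / h < e / t.
  by apply: cvgr_lt E0 _ (divr_gt0 e0 t0).
(* Makes the step t/m smaller than d, where E(h)/h < e/t, so that m E(t/m) is at most e. *)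
pose m := (Num.trunc (t / d)).+1.
have m0 : 0 < m%:R :> R by rewrite ltr0n.
have h0 : 0 < t / m%:R by rewrite divr_gt0.
have := stepE m 0 _ (ltW h0).
rewrite mul0r addn0 mulrC divfK ?gt_eqF// => /le_trans; apply.
under eq_bigr do rewrite window_semigroup0.
rewrite sum_nat_deltar// lerD2l.
have tmd : t / m%:R < d.
  by rewrite ltr_pdivrMr// mulrC -ltr_pdivrMr// truncnS_gt.
have := dE _ h0 tmd; rewrite ltr_pdivrMr// mulrA divfK ?gt_eqF// => /ltW.
by rewrite ler_pdivlMr// mulrC.
Unshelve. all: by end_near. Qed.

End comparison.

(** * Minimal transition functions *)

Lemma nneseries_finP (R : realType) (m : nat) (u : nat -> R) (c : R) :
  (forall n, (m <= n)%N -> 0 <= u n) ->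
  \sum_(m <= n < L) u n @[L --> \oo] --> c <->
  (\sum_(m <= n <oo) (u n)%:E)%E = c%:E.
Proof.
move=> u0; split => [uc|uc].
  apply: cvg_lim => //; under eq_fun do rewrite sumEFin.
  by apply: cvg_EFin uc; apply: nearW => L.
have : (\sum_(m <= n < L) (u n)%:E)%E @[L --> \oo] --> c%:E.
  rewrite -uc; apply: is_cvg_nneseries => n mn _; rewrite lee_fin; exact: u0.
move=> /fine_cvgP[_]; apply: cvg_trans; apply: near_eq_cvg; near=> L.
by rewrite /= sumEFin.
Unshelve. all: by end_near. Qed.

Lemma nneseries_le_finP (R : realType) (m : nat) (u : nat -> R) (c : R) :
  (forall n, (m <= n)%N -> 0 <= u n) ->
  (forall L, \sum_(m <= n < L) u n <= c) <->
  (\sum_(m <= n <oo) (u n)%:E <= c%:E)%E.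
Proof.
move=> u0; split => [uc|uc L].
  apply: lime_le.
    by apply: is_cvg_nneseries => n mn _; rewrite lee_fin u0.
  by apply: nearW => L; rewrite sumEFin lee_fin.
rewrite -lee_fin -sumEFin; apply: le_trans uc.
by apply: nneseries_lim_ge => n mn; rewrite lee_fin u0.
Qed.

(** The diagonal entry sums the exit rates only up to state i+1: for the upward skip-free rates
    considered here this is the whole exit rate, and it does not depend on the window. *)
Definition generator (R : realType) (r : nat) (q : nat -> nat -> R)
    (i j : nat) : R :=
  if i == j then - \sum_(r <= k < i.+2 | k != i) q i k else q i j.

(** Transition function of the chain killed on leaving [r, M). The value 0 outside the window makes
    it monotone in M without side conditions on i and j relative to M. *)
Definition window (R : realType) (r : nat) (q : nat -> nat -> R)
    (M i j : nat) (t : R) : R :=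
  if (i < M)%N && (j < M)%N then window_semigroup r M (generator r q) i j t
  else 0.

Section skip_free.
Variables (R : realType) (r : nat) (q : nat -> nat -> R).
Hypothesis q_ge0 : forall i j, (r <= i)%N -> (r <= j)%N -> i != j -> 0 <= q i j.
Hypothesis q_skip : forall i j, (r <= i)%N -> (i.+1 < j)%N -> q i j = 0.
Local Notation Q := (generator r q).
Local Notation w := (window r q).

Let Q_ge0 i j : (r <= i)%N -> (r <= j)%N -> i != j -> 0 <= Q i j.
Proof. by move=> ri rj ij; rewrite /generator (negbTE ij) q_ge0. Qed.

Lemma generator_row_sum L i : (r <= i)%N -> (i.+1 < L)%N ->
  \sum_(r <= j < L) Q i j = 0.
Proof.
move=> ri iL; rewrite (big_cat_nat (n := i.+2))//=; last lia.
rewrite [X in _ + X]big_nat_cond [X in _ + X]big1 => [|j]; last first.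
  by rewrite andbT => ji; rewrite /generator ifF ?q_skip//; lia.
rewrite addr0 (bigD1_seq i) ?mem_index_iota ?iota_uniq//=; last lia.
rewrite {1}/generator eqxx addrC; apply/eqP; rewrite subr_eq0; apply/eqP.
by apply: eq_bigr => j ji; rewrite /generator eq_sym (negbTE ji).
Qed.

(** Only the top state M-1 leaks: its row lacks the rate towards M, while every lower row is
    complete and sums to zero. *)
Let Q_le0 M i : (r <= i < M)%N -> \sum_(r <= j < M) Q i j <= 0.
Proof.
move=> /andP[ri]; rewrite leq_eqVlt => /predU1P[<-|iM]; last first.
  by rewrite generator_row_sum.
have := @generator_row_sum i.+2 i ri (ltnSn _).
rewrite big_nat_recr/=; last lia.
by move=> /eqP; rewrite addr_eq0 => /eqP ->; rewrite oppr_le0 Q_ge0//; lia.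
Qed.

Lemma window_nat M i j t : (r <= i < M)%N -> (r <= j < M)%N ->
  w M i j t = window_semigroup r M Q i j t.
Proof. by move=> /andP[_ iM] /andP[_ jM]; rewrite /window iM jM. Qed.

Let QM_ge0 M i j : (r <= i < M)%N -> (r <= j < M)%N -> i != j -> 0 <= Q i j.
Proof. by move=> /andP[? _] /andP[? _]; exact: Q_ge0. Qed.

Lemma window_ge0 M i j t : (r <= j)%N -> 0 <= t -> 0 <= w M i j t.
Proof.
move=> rj t0; rewrite /window; case: ifP => // /andP[iM jM].
apply: (window_semigroup_ge0 (@QM_ge0 M)) => //; lia.
Qed.

Let window_sum M i t : (r <= i < M)%N -> \sum_(r <= j < M) w M i j t =
  \sum_(r <= j < M) window_semigroup r M Q i j t.
Proof. by move=> iM; apply: eq_big_nat => j jM; rewrite window_nat. Qed.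

Let window_sum0 M i t : (M <= i)%N -> \sum_(r <= j < M) w M i j t = 0.
Proof. by move=> Mi; rewrite big1// => j _; rewrite /window ltnNge Mi. Qed.

Lemma window_mass_le1 M i t : (r <= i)%N -> 0 <= t ->
  \sum_(r <= j < M) w M i j t <= 1.
Proof.
move=> ri t0; have [iM|/window_sum0->//] := ltnP i M.
have riM : (r <= i < M)%N by rewrite ri.
rewrite window_sum//; apply: (window_semigroup_mass_le1 (@QM_ge0 M)) => //.
exact: Q_le0.
Qed.

Lemma window_mass_nincr M i s t : (r <= i)%N -> 0 <= s -> s <= t ->
  \sum_(r <= j < M) w M i j t <= \sum_(r <= j < M) w M i j s.
Proof.
move=> ri s0 st; have [iM|iM] := ltnP i M; last by rewrite !window_sum0.
have riM : (r <= i < M)%N by rewrite ri.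
rewrite !window_sum//; apply: (window_semigroup_mass_nincr (@QM_ge0 M)) => //.
exact: Q_le0.
Qed.

Lemma window_le1 M i j t : (r <= i)%N -> (r <= j)%N -> 0 <= t -> w M i j t <= 1.
Proof.
move=> ri rj t0; rewrite /window; case: ifP => // /andP[iM jM].
by apply: (window_semigroup_le1 (@QM_ge0 M)) => //; [exact: Q_le0|lia..].
Qed.

Lemma window0 M i j : (i < M)%N -> (j < M)%N -> w M i j 0 = (i == j)%:R.
Proof. by move=> iM jM; rewrite /window iM jM window_semigroup0. Qed.

Lemma window_rate M i j : (r <= i < M)%N -> (r <= j < M)%N ->
  (w M i j h - (i == j)%:R) / h @[h --> 0^'+] --> Q i j.
Proof.
move=> iM jM; under eq_fun do rewrite window_nat//.
exact: window_semigroup_rate.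
Qed.

Lemma windowD M i j s t : (r <= i < M)%N -> (r <= j < M)%N -> 0 <= t ->
  w M i j (s + t) = \sum_(r <= l < M) w M i l s * w M l j t.
Proof.
move=> iM jM t0; rewrite window_nat// window_semigroupD//.
by apply: eq_big_nat => l lM; rewrite !window_nat.
Qed.

Lemma window_le (A : nat -> nat -> R -> R) M :
  (forall i j t, (r <= i < M)%N -> (r <= j < M)%N -> 0 <= t ->
    0 <= A i j t <= 1) ->
  (forall i j, (r <= i < M)%N -> (r <= j < M)%N -> A i j 0 = (i == j)%:R) ->
  (forall i j s t, (r <= i < M)%N -> (r <= j < M)%N -> 0 <= s -> 0 <= t ->
    \sum_(r <= l < M) A i l s * A l j t <= A i j (s + t)) ->
  (forall i j, (r <= i < M)%N -> (r <= j < M)%N ->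
    (A i j h - (i == j)%:R) / h @[h --> 0^'+] --> Q i j) ->
  forall i j t, (r <= i < M)%N -> (r <= j < M)%N -> 0 <= t ->
    w M i j t <= A i j t.
Proof.
move=> A01 A0 AM AQ i j t iM jM t0; rewrite window_nat//.
by apply: (window_semigroup_le (@QM_ge0 M)) => //; exact: Q_le0.
Qed.

(** The larger window, restricted to the smaller one, is supermultiplicative, because passages
    through the state M are dropped, and has the same rates, so the comparison applies. *)
Lemma window_nondecreasing i j t : (r <= i)%N -> (r <= j)%N -> 0 <= t ->
  nondecreasing_seq (fun M => w M i j t).
Proof.
move=> ri rj t0; apply/nondecreasing_seqP => M.
have [iM|iM] := ltnP i M; last first.
  by rewrite {1}/window ltnNge iM/= window_ge0.
have [jM|jM] := ltnP j M; last first.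
  by rewrite {1}/window [(j < M)%N]ltnNge jM andbF window_ge0.
apply: (@window_le (w M.+1)) => //; [|..|lia|lia].
- by move=> k l u kM lM u0; rewrite window_ge0 ?window_le1//; lia.
- by move=> k l kM lM; rewrite window0//; lia.
- move=> k l s u kM lM s0 u0; rewrite windowD//; [|lia..].
  by rewrite [leRHS]big_nat_recr/= ?lerDl ?mulr_ge0 ?window_ge0//; lia.
- by move=> k l kM lM; apply: window_rate; lia.
Qed.

(** Merges the diagonal and off-diagonal clauses into one entrywise derivative at 0. Skip-freeness
    makes the exit rate a finite sum, so the extended-real limit becomes a real one. *)
Lemma has_ratesP (p : nat -> nat -> R -> R) :
  has_rates r q p <->
  (forall i j, (r <= i)%N -> (r <= j)%N ->
    (p i j h - (i == j)%:R) / h @[h --> 0^'+] --> Q i j).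
Proof.
have sumE i : (r <= i)%N ->
    (\sum_(r <= n <oo | n != i) (q i n)%:E)%E = (- Q i i)%:E.
  move=> ri; rewrite /generator eqxx opprK; apply: lim_near_cst => //.
  exists i.+2 => // L /= iL; rewrite (big_cat_nat (n := i.+2))//=; last lia.
  rewrite [X in (_ + X)%E]big_nat_cond [X in (_ + X)%E]big1 ?adde0 ?sumEFin//.
  by move=> n /andP[/andP[ni _] _]; rewrite q_skip.
split=> [[poff pdiag] i j ri rj|pQ].
  have [<-|ij] := eqVneq i j; last first.
    rewrite /generator (negbTE ij); under eq_fun do rewrite subr0.
    exact: poff.
  under eq_fun do rewrite -opprB mulNr.
  rewrite -[Q i i]opprK; apply: cvgN.
  by have := pdiag _ ri; rewrite sumE// => /fine_cvg.
split=> [i j ri rj ij|i ri].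
  have := pQ _ _ ri rj; rewrite /generator (negbTE ij).
  by under eq_fun do rewrite subr0.
rewrite sumE//; apply: cvg_EFin; first exact: nearW.
have := pQ _ _ ri ri; rewrite eqxx => /cvgN; apply: cvg_trans.
by apply: near_eq_cvg; near=> h; rewrite /= fctE -mulNr opprB.
Unshelve. all: by end_near. Qed.

(** Truncating the Chapman-Kolmogorov sum to the window drops nonnegative terms, so every transition
    function is supermultiplicative there. *)
Lemma window_le_transition (p : nat -> nat -> R -> R) :
  transition_function r p -> has_rates r q p ->
  forall M i j t, (r <= i)%N -> (r <= j)%N -> 0 <= t -> w M i j t <= p i j t.
Proof.
move=> [p_ge0 p_le1 p0 pD] /has_ratesP pQ M i j t ri rj t0.
have [iM|Mi] := ltnP i M; last by rewrite /window ltnNge Mi p_ge0.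
have [jM|Mj] := ltnP j M; last first.
  by rewrite /window [(j < M)%N]ltnNge Mj andbF p_ge0.
apply: window_le => //; [| | | |lia|lia].
- move=> k l u /andP[rk _] /andP[rl _] u0; rewrite p_ge0//=.
  have /nneseries_le_finP := p_le1 _ _ rk u0.
  move=> /(_ (fun n rn => p_ge0 _ _ _ rk rn u0) l.+1).
  rewrite big_nat_recr//=; apply: le_trans; rewrite lerDr.
  by rewrite big_nat_cond sumr_ge0// => n /andP[/andP[rn _] _]; rewrite p_ge0.
- by move=> k l /andP[rk _] /andP[rl _]; rewrite p0.
- move=> k l u v /andP[rk _] /andP[rl _] u0 v0.
  have /eqP := pD _ _ _ _ rk rl u0 v0; rewrite eq_le => /andP[+ _].
  move=> /nneseries_le_finP; apply=> n rn.
  by rewrite mulr_ge0// p_ge0.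
- by move=> k l /andP[rk _] /andP[rl _]; exact: pQ.
Qed.

Let min_chain i j t : R := limn (fun M => w M i j t).

Let min_cvg i j t : (r <= i)%N -> (r <= j)%N -> 0 <= t ->
  w M i j t @[M --> \oo] --> min_chain i j t.
Proof.
move=> ri rj t0; apply: nondecreasing_is_cvgn.
  exact: window_nondecreasing.
by exists 1 => _ [M _ <-]; exact: window_le1.
Qed.

Let le_min M i j t : (r <= i)%N -> (r <= j)%N -> 0 <= t ->
  w M i j t <= min_chain i j t.
Proof.
move=> ri rj t0; apply: nondecreasing_cvgn_le.
  exact: window_nondecreasing.
by apply/cvg_ex; eexists; exact: min_cvg.
Qed.

Let min_ge0 i j t : (r <= i)%N -> (r <= j)%N -> 0 <= t -> 0 <= min_chain i j t.
Proof. exact: (le_min 0). Qed.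

Let min_le i j t c : (r <= i)%N -> (r <= j)%N -> 0 <= t ->
  (\forall M \near \oo, w M i j t <= c) -> min_chain i j t <= c.
Proof.
move=> ri rj t0 wc; apply: limr_le => //.
by apply/cvg_ex; eexists; exact: min_cvg.
Qed.

Let min_mass_le1 L i t : (r <= i)%N -> 0 <= t ->
  \sum_(r <= j < L) min_chain i j t <= 1.
Proof.
move=> ri t0.
have cv : \sum_(r <= j < L) w M i j t @[M --> \oo] -->
    \sum_(r <= j < L) min_chain i j t.
  by apply: cvg_sum_nat => j /andP[rj _]; exact: min_cvg.
rewrite -(cvg_lim _ cv)//; apply: limr_le.
  by apply/cvg_ex; eexists; exact: cv.
near=> M; apply: le_trans (window_mass_le1 M ri t0).
have LM : (L <= M)%N by near: M; exists L.
have [Lr|rL] := leqP L r.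
  rewrite big_geq// big_nat_cond sumr_ge0// => j /andP[/andP[rj _] _].
  exact: window_ge0.
rewrite [leRHS](big_cat_nat (n := L))//=; last lia.
rewrite lerDl big_nat_cond sumr_ge0// => j /andP[/andP[Lj _] _].
by apply: window_ge0 => //; lia.
Unshelve. all: by end_near. Qed.

Let min_chain_transition : transition_function r min_chain.
Proof.
split=> [i j t|i t|i j|i j s t] ri.
- exact: min_ge0.
- move=> t0; apply/nneseries_le_finP => [j rj|L]; first exact: min_ge0.
  exact: min_mass_le1.
- move=> rj; apply: lim_near_cst => //; near=> M.
  by rewrite window0//; near: M; [exists i.+1|exists j.+1].
- move=> rj s0 t0; apply/nneseries_finP.
    by move=> n rn; rewrite mulr_ge0// min_ge0.
  set S := fun L => \sum_(r <= k < L) min_chain i k s * min_chain k j t.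
  have st0 : 0 <= s + t by rewrite addr_ge0.
  (* The partial sum over [r, M) lies between the window M at time s + t, by the semigroup law of
     that window, and the limit at time s + t. *)
  apply: (@squeeze_cvgr _ _ _ _ (fun M => w M i j (s + t))
    (cst (min_chain i j (s + t)))).
  + near=> M; have iM : (i < M)%N by near: M; exists i.+1.
    have jM : (j < M)%N by near: M; exists j.+1.
    apply/andP; split.
      rewrite windowD ?ri ?rj// /S; apply: ler_sum_nat => k /andP[rk _].
      by rewrite ler_pM ?le_min ?window_ge0.
    (* Upper bound: with M fixed, compare with windows L >= M, whose semigroup law contains the
       truncated sum, and let L grow. *)
    have cv : \sum_(r <= k < M) w L i k s * w L k j t @[L --> \oo] --> S M.
      by apply: cvg_sum_nat => k /andP[rk _]; apply: cvgM; exact: min_cvg.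
    rewrite -(cvg_lim _ cv)//; apply: limr_le.
      by apply/cvg_ex; eexists; exact: cv.
    near=> L; apply: le_trans (le_min L ri rj st0).
    have ML : (M <= L)%N by near: L; exists M.
    rewrite windowD//; [|lia..].
    rewrite [leRHS](big_cat_nat (n := M))//=; last lia.
    rewrite lerDl big_nat_cond sumr_ge0// => k /andP[/andP[Mk _] _].
    by rewrite mulr_ge0 ?window_ge0//; lia.
  + exact: min_cvg.
  + exact: cvg_cst.
Unshelve. all: by end_near. Qed.

(* The lower bound on [(p_ij(h) - delta_ij) / h] comes from a window, and the
   upper bound from the mass that the window leaves in the other states. *)
Let min_chain_rates : has_rates r q min_chain.
Proof.
apply/has_ratesP => i j ri rj.
(* The window has to contain i+1: the row of i then sums to zero, so the correction in [u] vanishes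
   in the limit. *)
pose M := (maxn i j).+2.
have [iM jM] : ((i.+1 < M) /\ (j < M))%N by rewrite /M; lia.
have riM : (r <= i < M)%N by lia.
have rjM : (r <= j < M)%N by lia.
pose u h := (w M i j h - (i == j)%:R) / h -
  \sum_(r <= k < M) (w M i k h - (i == k)%:R) / h.
apply: (@squeeze_cvgr _ _ _ _ (fun h => (w M i j h - (i == j)%:R) / h) u).
- near=> h.
  have h0 : 0 < h by [].
  have hV0 : 0 < h^-1 by rewrite invr_gt0.
  apply/andP; split.
    apply: ler_wpM2r; first exact: ltW.
    by rewrite lerB// le_min// ltW.
  rewrite /u -mulr_suml -mulrBl; apply: ler_wpM2r; first exact: ltW.
  rewrite addrAC lerB// sumrB.
  have -> : \sum_(r <= k < M) (i == k)%:R = 1 :> R.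
    rewrite -[RHS](@sum_nat_deltal R r M i (fun=> 1))//.
    by apply: eq_bigr => k _; rewrite mulr1.
  suff : min_chain i j h - w M i j h <= 1 - \sum_(r <= k < M) w M i k h by lra.
  apply: (@le_trans _ _ (\sum_(r <= k < M) (min_chain i k h - w M i k h))).
    rewrite [leRHS](bigD1_seq j) ?mem_index_iota ?iota_uniq//= lerDl.
    rewrite big_nat_cond sumr_ge0// => k /andP[/andP[rk _] _].
    by rewrite subr_ge0 le_min// ltW.
  by rewrite sumrB lerB// min_mass_le1// ltW.
- exact: window_rate.
- have -> : Q i j = Q i j - \sum_(r <= k < M) Q i k.
    by rewrite generator_row_sum ?subr0.
  apply: cvgB; first exact: window_rate.
  by apply: cvg_sum_nat => k kM; exact: window_rate.
Unshelve. all: by end_near. Qed.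

(** The limit of the windows is a transition function with the given rates, so minimality puts p
    below it; every window lies below p, which gives the converse. *)
Lemma chain_transitions_window (p : nat -> nat -> R -> R) :
  chain_transitions r q p -> forall i j t, (r <= i)%N -> (r <= j)%N -> 0 <= t ->
  w M i j t @[M --> \oo] --> p i j t.
Proof.
move=> [ptrans prates pmin] i j t ri rj t0.
suff -> : p i j t = min_chain i j t by exact: min_cvg.
apply/eqP; rewrite eq_le (pmin _ min_chain_transition min_chain_rates)//=.
apply: min_le => //.
by apply: nearW => M; exact: window_le_transition.
Qed.

End skip_free.

(** * Maximum principle *)

(** Applies the one-sided derivative at 0 to h |-> f (t - h), whose difference quotients are
    nonpositive. *)
Lemma is_derive_left_max_ge0 (R : realType) (f : R -> R) (t l : R) :
  0 < t -> is_derive t 1 f l -> (forall s, 0 <= s <= t -> f s <= f t) -> 0 <= l.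
Proof.
move=> t0 fl fmax; rewrite -oppr_le0.
have := is_derive_at_right (@is_derive_subr _ f t 0 l _).
rewrite subr0 => /(_ fl) cv; rewrite -(cvg_lim _ cv)//.
apply: limr_le; first by apply/cvg_ex; eexists; exact: cv.
near=> h; have h0 : 0 < h by [].
rewrite pmulr_lle0 ?invr_gt0// subr_le0; apply: fmax.
apply/andP; split; last by rewrite gerBl ltW.
by rewrite subr_ge0 ltW//; near: h; exact: nbhs_right_lt.
Unshelve. all: by end_near. Qed.

(* A discrete parabolic maximum principle: an excess over [C], tilted by
   [- e t], would have an interior maximum at which the derivative is both
   nonnegative and at most [- e]. *)
Lemma parabolic_max_principle (R : realType) (r M : nat) (T C : R)
    (D dD : nat -> R -> R) :
  (forall n (t : R), (r < n < M)%N -> is_derive t 1 (D n) (dD n t)) ->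
  (forall t, 0 <= t <= T -> D r t <= C) ->
  (forall t, 0 <= t <= T -> D M t <= C) ->
  (forall n, (r < n < M)%N -> D n 0 <= C) ->
  (forall n t, (r < n < M)%N -> 0 <= t <= T -> C < D n t ->
    D n.-1 t <= D n t -> D n.+1 t <= D n t -> dD n t <= 0) ->
  forall n t, (r < n < M)%N -> 0 <= t <= T -> D n t <= C.
Proof.
have inner n : (r <= n <= M)%N -> n != r -> n != M -> (r < n < M)%N by lia.
have outer n : (r < n < M)%N -> (r <= n.-1 <= M)%N /\ (r <= n.+1 <= M)%N by lia.
move=> DdD Dr DM D0 dD0 n1 t1 n1M t1T.
apply/ler_addgt0Pr => e' e'0.
have T0 : 0 <= T by move: t1T => /andP[]; exact: le_trans.
(* Over [0, T] the tilt then costs at most e'; the + 1 covers T = 0. *)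
pose e := e' / (T + 1).
have e0 : 0 < e by rewrite divr_gt0// ltr_wpDl.
pose E n t := D n t - e * t.
suff : E n1 t1 <= C.
  move=> E1; rewrite -lerBlDr (le_trans _ E1)// /E lerB// /e.
  rewrite mulrAC ler_pdivrMr ?ltr_wpDl// ler_pM2l//.
  by move: t1T => /andP[_]; lra.
rewrite leNgt; apply/negP => E1.
(* A maximum over both variables: first a maximising time for each n, then the best of the finitely
   many n. *)
have /boolp.choice[s sP] n : exists u, (r < n < M)%N ->
    0 <= u <= T /\ forall t, 0 <= t <= T -> E n t <= E n u.
  have [nM|nM] := boolP (r < n < M)%N; last by exists 0.
  have [|u uT umax] := @EVT_max R (E n) 0 T T0.
    apply: continuous_subspaceT => x.
    apply: continuousB; first exact: is_derive_cts (DdD n x nM).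
    by apply: continuousM; [exact: cst_continuous|].
  exists u => _; split=> [|t tT]; first by move: uT; rewrite in_itv.
  by apply: umax; rewrite in_itv.
have n1M' : (n1 < M)%N by case/andP: n1M.
case: (@Order.TotalTheory.arg_maxP _ _ _ (Ordinal n1M')
  (fun i : 'I_M => (r < i)%N) (fun i : 'I_M => E i (s i))) => [|i /= ri imax].
  by case/andP: n1M.
have iM : (r < i < M)%N by rewrite ri ltn_ord.
have Emax n t : (r < n < M)%N -> 0 <= t <= T -> E n t <= E i (s i).
  move=> /[dup] nM /andP[rn nM'] tT; apply: le_trans (proj2 (sP n nM) t tT) _.
  exact: (imax (Ordinal nM')).
have [siT smax] := sP i iM.
have Ei : C < E i (s i) by apply: lt_le_trans E1 (Emax _ _ n1M t1T).
have ED : E i (s i) <= D i (s i).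
  by rewrite /E gerBl mulr_ge0// ?(ltW e0)//; case/andP: siT.
have si0 : 0 < s i.
  case/andP: siT; rewrite le_eqVlt => /predU1P[si0|//] _.
  by have := D0 _ iM; rewrite si0 leNgt (lt_le_trans Ei ED).
(* At the common time [s i] the tilts cancel, so maximality of E passes to D; at the boundary states
   D is at most C, hence below the maximum. *)
have nbr n : (r <= n <= M)%N -> D n (s i) <= D i (s i).
  have [->|nr] := eqVneq n r.
    by move=> _; rewrite (le_trans (Dr _ siT))// ltW// (lt_le_trans Ei).
  have [->|nM] := eqVneq n M.
    by move=> _; rewrite (le_trans (DM _ siT))// ltW// (lt_le_trans Ei).
  move=> rnM; have : E n (s i) <= E i (s i) by apply: Emax => //; exact: inner.
  by rewrite /E lerD2r.
have dle : dD i (s i) <= 0.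
  have [im ip] := outer _ iM.
  by apply: dD0 => //; [exact: lt_le_trans ED|exact: nbr..].
have : 0 <= dD i (s i) - e.
  apply: (@is_derive_left_max_ge0 _ (E i) (s i)) => //.
    have dE : is_derive (s i) 1 (fun t => e * t) e.
      apply: (is_derive_eq (is_deriveZ e (is_derive_id (s i) 1))); exact: mulr1.
    exact: is_deriveB (DdD _ _ iM) dE.
  move=> t /andP[t0 ti]; apply: smax; rewrite t0 (le_trans ti)//.
  by case/andP: siT.
by move: dle e0; lra.
Qed.

Section birth_death_bound.
Variables (R : realType) (r M : nat) (T C xi : R) (a b : nat -> R).
Hypothesis a_ge0 : forall n, (r < n < M)%N -> 0 <= a n.
Hypothesis b_ge0 : forall n, (r < n < M)%N -> 0 <= b n.
Hypothesis xi_ge0 : 0 <= xi.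

(** The forward equation of a tail, perturbed by a source [e] that will be the mass lost by a
    window; [a n] stands for the birth rate out of n-1. *)
Let drift (D : nat -> R -> R) (e : R -> R) n t :=
  a n * (D n.-1 t - D n t) - b n * (D n t - D n.+1 t) - xi * (D n t + e t).

(** Where D_n exceeds C and dominates both neighbours, the birth and death terms are nonpositive,
    and so is the catastrophe term because e >= -C. *)
Let birth_death_le (D : nat -> R -> R) (e : R -> R) :
  (forall n (t : R), (r < n < M)%N -> is_derive t 1 (D n) (drift D e n t)) ->
  (forall t, 0 <= t <= T -> - C <= e t) ->
  (forall t, 0 <= t <= T -> D r t <= C) ->
  (forall t, 0 <= t <= T -> D M t <= C) ->
  (forall n, (r < n < M)%N -> D n 0 <= C) ->
  forall n t, (r < n < M)%N -> 0 <= t <= T -> D n t <= C.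
Proof.
move=> DdD eC Dr DM D0; apply: parabolic_max_principle DdD Dr DM D0 _.
move=> n t nM tT CD D1 D2; rewrite /drift.
have h1 : 0 <= a n * (D n t - D n.-1 t) by rewrite mulr_ge0 ?a_ge0// subr_ge0.
have h2 : 0 <= b n * (D n t - D n.+1 t) by rewrite mulr_ge0 ?b_ge0// subr_ge0.
have h3 : 0 <= xi * (D n t + e t).
  by rewrite mulr_ge0//; have := eC _ tT; move: CD; lra.
by move: h1 h2 h3; rewrite !mulrBr; lra.
Qed.

(** The equation is linear in the pair (D, e), so the one-sided bound applies to (-D, -e) as
    well. *)
Lemma birth_death_bound (D : nat -> R -> R) (e : R -> R) :
  (forall n (t : R), (r < n < M)%N -> is_derive t 1 (D n) (drift D e n t)) ->
  (forall t, 0 <= t <= T -> `|e t| <= C) ->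
  (forall t, 0 <= t <= T -> `|D r t| <= C) ->
  (forall t, 0 <= t <= T -> `|D M t| <= C) ->
  (forall n, (r < n < M)%N -> `|D n 0| <= C) ->
  forall n t, (r < n < M)%N -> 0 <= t <= T -> `|D n t| <= C.
Proof.
have absl (x : R) : `|x| <= C -> - C <= x by case/ler_normlP; rewrite lerNl.
have absN (x : R) : `|x| <= C -> - x <= C by case/ler_normlP.
have absr (x : R) : `|x| <= C -> x <= C by case/ler_normlP.
move=> DdD eC Dr DM D0 n t nM tT; apply/ler_normlP; split.
  apply: (@birth_death_le (fun n t => - D n t) (fun t => - e t)) nM tT.
  - move=> k u kM; apply: (is_derive_eq (is_deriveN (DdD k u kM))).
    by rewrite /drift; ring.
  - by move=> u uT; rewrite lerN2 absr// eC.
  - by move=> u uT; rewrite absN// Dr.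
  - by move=> u uT; rewrite absN// DM.
  - by move=> k kM; rewrite absN// D0.
apply: (birth_death_le DdD) nM tT.
- by move=> u uT; rewrite absl// eC.
- by move=> u uT; rewrite absr// Dr.
- by move=> u uT; rewrite absr// DM.
- by move=> k kM; rewrite absr// D0.
Qed.

End birth_death_bound.

(** * Catastrophes and duality of tails *)

Lemma sum_nat_eq (R : realType) (m n j : nat) :
  \sum_(m <= k < n) (k == j)%:R = (m <= j < n)%N%:R :> R.
Proof.
transitivity (\sum_(m <= k < n | k == j) (1 : R)).
  by rewrite [RHS]big_mkcond/=; apply: eq_bigr => k _; case: eqP.
by rewrite big_nat1_eq; case: ifP.
Qed.

Section catastrophe_window.
Variables (R : realType) (r : nat) (alpha beta : nat -> R) (xi : R).
Local Notation rate := (catastrophe_rate r alpha beta xi).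
Local Notation w := (window r rate).

Lemma catastrophe_rate_skip i j : (r <= i)%N -> (i.+1 < j)%N -> rate i j = 0.
Proof.
move=> ri ij; rewrite /catastrophe_rate ifF; last lia.
rewrite ifF; last lia.
rewrite ifF; last lia.
by rewrite ifF//; lia.
Qed.

Lemma catastrophe_rate_up i : rate i i.+1 = alpha i.
Proof. by rewrite /catastrophe_rate eqxx. Qed.

(** One formula for all downward jumps: at i = r+1 both indicators hold and the rates add up to
    beta_(r+1) + xi. *)
Lemma catastrophe_rate_down i j : (r <= j < i)%N ->
  rate i j = xi * (j == r)%:R + beta i * (j == i.-1)%:R.
Proof.
move=> /andP[rj ji]; rewrite /catastrophe_rate ifF; last lia.
have [ir|ir] := eqVneq i r.+1.
  have -> : j = r by lia.
  by rewrite ir !eqxx !mulr1 addrC.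
have ir2 : (r.+2 <= i)%N by lia.
rewrite /= ir2/=; have [->|ji'] := eqVneq j i.-1.
  have -> : (i.-1 == r) = false by lia.
  by rewrite mulr0 add0r mulr1.
by case: eqP => _; rewrite ?mulr0 ?mulr1 ?addr0.
Qed.

(** The generator applied to the indicator of [r, n). That set is entered from l >= n by a
    catastrophe, or by a death if l = n, and left only by a birth from n-1; for lower l the complete
    row sums to zero. *)
Lemma catastrophe_cumulative_rate n l : (r < n)%N -> (r <= l)%N ->
  \sum_(r <= k < n) generator r rate l k =
  xi * (n <= l)%:R + (l == n)%:R * beta n - (l == n.-1)%:R * alpha n.-1.
Proof.
move=> rn rl; have skip := catastrophe_rate_skip.
have [ln|nl] := ltnP l n; last first.
  have -> : (l == n.-1) = false by lia.
  rewrite mul0r subr0 mulr1.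
  transitivity (\sum_(r <= k < n)
      (xi * (k == r)%:R + beta l * (k == l.-1)%:R)).
    apply: eq_big_nat => k /andP[rk kn].
    by rewrite /generator ifF ?catastrophe_rate_down//; lia.
  rewrite big_split/= -!mulr_sumr.
  rewrite !sum_nat_eq; have -> : (r <= r < n)%N by lia.
  have -> : (r <= l.-1 < n)%N = (l == n) by lia.
  by rewrite mulr1 mulrC; case: eqP => [->|]; rewrite ?mul1r// !mul0r.
have -> : (l == n) = false by lia.
rewrite mulr0 mul0r !add0r.
have [ln1|ln1] := eqVneq l n.-1; last first.
  by rewrite generator_row_sum ?mul0r ?oppr0//; lia.
have -> : n = l.+1 by lia.
rewrite mul1r; have := generator_row_sum skip rl (ltnSn l.+1).
rewrite big_nat_recr/=; last lia.
move=> /eqP; rewrite addr_eq0 => /eqP ->.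
by rewrite /generator ifF ?catastrophe_rate_up//; lia.
Qed.

Lemma catastrophe_rate_ge0 i j :
  (forall n, (r <= n)%N -> 0 <= alpha n) ->
  (forall n, (r < n)%N -> 0 <= beta n) -> 0 <= xi ->
  (r <= i)%N -> (r <= j)%N -> i != j ->
  0 <= rate i j.
Proof.
move=> alpha_ge0 beta_ge0 xi_ge0 ri rj ij; rewrite /catastrophe_rate.
case: eqP => _; first exact: alpha_ge0.
case: ifP => _; first by rewrite addr_ge0// beta_ge0.
case: ifP => [/andP[ir _]|_]; first by rewrite beta_ge0//; lia.
by case: ifP.
Qed.

(** Being a complement, this counts the killed mass as lying above every state; at n = M it is
    exactly the mass lost by the window. *)
Definition window_tail (M n : nat) (t : R) : R :=
  1 - \sum_(r <= k < n) w M r k t.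
Local Notation F := window_tail.

Lemma window_tailS M n t : (r <= n)%N -> F M n t - F M n.+1 t = w M r n t.
Proof. by move=> rn; rewrite /F big_nat_recr//=; ring. Qed.

(** The forward equations summed over the states below n. Catastrophes act only on the surviving
    mass, hence F_n - F_M in the last term. *)
Lemma window_tail_is_derive M n (t : R) : (r < n < M)%N ->
  is_derive t 1 (F M n) (alpha n.-1 * (F M n.-1 t - F M n t) -
    beta n * (F M n t - F M n.+1 t) - xi * (F M n t - F M M t)).
Proof.
move=> /andP[rn nM].
have rM : (r <= r < M)%N by lia.
have dw k : (r <= k < n)%N -> is_derive t 1 (w M r k)
    (\sum_(r <= l < M) w M r l t * generator r rate l k).
  move=> kn; have kM : (r <= k < M)%N by lia.
  have -> : w M r k = window_semigroup r M (generator r rate) r k.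
    by apply/funext => s; rewrite window_nat.
  apply: (is_derive_eq (window_semigroup_forward (generator r rate) t rM kM)).
  by apply: eq_big_nat => l lM; rewrite window_nat.
have := @is_derive_sum_nat _ r n (fun k => w M r k) (fun k t =>
   \sum_(r <= l < M) w M r l t * generator r rate l k) t dw.
move=> /(is_deriveB (is_derive_cst (1 : R) t 1)) dS; apply: (is_derive_eq dS).
rewrite sub0r exchange_big/=.
have -> : F M n t - F M M t = \sum_(r <= l < M) w M r l t * (n <= l)%:R.
  rewrite (big_cat_nat (n := n))/=; [|lia..].
  rewrite big_nat_cond big1 => [|l /andP[/andP[_ ln] _]]; last first.
    by rewrite leqNgt ln mulr0.
  rewrite add0r /F [X in _ - (1 - X)](big_cat_nat (n := n))/=; [|lia..].
  transitivity (\sum_(n <= l < M) w M r l t); first by ring.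
  by apply: eq_big_nat => l /andP[-> _]; rewrite mulr1.
rewrite (@eq_big_nat _ _ _ _ _ _ (fun l => xi * (w M r l t * (n <= l)%:R) +
  w M r l t * (l == n)%:R * beta n - w M r l t * (l == n.-1)%:R * alpha n.-1)).
  rewrite sumrB big_split/= -mulr_sumr -!mulr_suml !sum_nat_deltar; [|lia..].
  rewrite -(@window_tailS M n.-1); last lia.
  rewrite -(@window_tailS M n); last lia.
  by rewrite prednK; [ring|lia].
move=> l /andP[rl _].
by rewrite -mulr_sumr catastrophe_cumulative_rate//; ring.
Qed.

End catastrophe_window.

Lemma sum_nat_sub_le (R : realType) (r m n M : nat) (u : nat -> R) :
  (forall k, (r <= k)%N -> 0 <= u k) -> (r <= m)%N -> (m <= n <= M)%N ->
  \sum_(m <= k < n) u k <= \sum_(r <= k < M) u k.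
Proof.
move=> u0 rm /andP[mn nM].
have sum0 i j : (r <= i)%N -> 0 <= \sum_(i <= k < j) u k.
  move=> ri; rewrite big_nat_cond sumr_ge0// => k /andP[/andP[ik _] _].
  by rewrite u0//; exact: leq_trans ik.
rewrite [leRHS](big_cat_nat (n := m))//=; last exact: leq_trans nM.
rewrite [X in _ <= _ + X](big_cat_nat (n := n))//=.
by rewrite addrCA lerDl addr_ge0// sum0//; exact: leq_trans mn.
Qed.

(** * Steady state and the product formula for tails *)

Section duality.
Variables (R : realType) (r : nat) (alpha beta : nat -> R) (xi : R).
Hypothesis alpha_gt0 : forall n, (r <= n)%N -> 0 < alpha n.
Hypothesis beta_ge0 : forall n, (r < n)%N -> 0 <= beta n.
Hypothesis xi_gt0 : 0 < xi.
Variables (p : nat -> nat -> R -> R) (q : nat -> R).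
Local Notation rate := (catastrophe_rate r alpha beta xi).
Hypothesis p_chain : chain_transitions r rate p.
Hypothesis q_lim : forall n, (r <= n)%N -> p r n t @[t --> +oo] --> q n.
Hypothesis q_sum : (\sum_(r <= n <oo) (q n)%:E = 1)%E.
Local Notation w := (window r rate).
Local Notation F := (window_tail r alpha beta xi).

Let ltn_pred_leq k : (r < k)%N -> (r <= k.-1)%N. Proof. by case: k. Qed.

Let alpha_ge0 n : (r <= n)%N -> 0 <= alpha n.
Proof. by move=> rn; rewrite ltW// alpha_gt0. Qed.

Let xi_ge0 : 0 <= xi. Proof. exact: ltW. Qed.

Let rate_ge0 i j : (r <= i)%N -> (r <= j)%N -> i != j -> 0 <= rate i j.
Proof. exact: catastrophe_rate_ge0. Qed.
Let rate_skip := @catastrophe_rate_skip R r alpha beta xi.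

Let p_ge0 n t : (r <= n)%N -> 0 <= t -> 0 <= p r n t.
Proof. by case: p_chain => p_tf _ _; exact: (tf_ge0 p_tf). Qed.

Let p_mass_le1 L t : 0 <= t -> \sum_(r <= n < L) p r n t <= 1.
Proof.
case: p_chain => p_tf _ _ t0.
have /nneseries_le_finP := tf_sum_le1 p_tf (leqnn r) t0.
by apply => n rn; exact: p_ge0.
Qed.

Let w_ge0 M n t : (r <= n)%N -> 0 <= t -> 0 <= w M r n t.
Proof. exact: window_ge0. Qed.

Let w_le_p M n t : (r <= n)%N -> 0 <= t -> w M r n t <= p r n t.
Proof.
move=> rn t0; case: p_chain => p_tf p_rates _.
exact: (window_le_transition rate_ge0 rate_skip p_tf p_rates).
Qed.

Let w_cvg n t : (r <= n)%N -> 0 <= t -> w M r n t @[M --> \oo] --> p r n t.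
Proof. by move=> rn; exact: (chain_transitions_window rate_ge0 rate_skip). Qed.

Let q_ge0 n : (r <= n)%N -> 0 <= q n.
Proof.
move=> rn; rewrite -(cvg_lim _ (q_lim rn))//.
apply: limr_ge; first by apply/cvg_ex; eexists; exact: q_lim.
by near=> t; apply: p_ge0.
Unshelve. all: by end_near. Qed.

Let q_sum_cvg : \sum_(r <= n < L) q n @[L --> \oo] --> (1 : R).
Proof. by apply/nneseries_finP. Qed.

(* The mass of [p r . t] is nonincreasing in [t], and at least [1] in the limit
   by Fatou. *)
Let p_mass t : 0 <= t -> \sum_(r <= n < L) p r n t @[L --> \oo] --> (1 : R).
Proof.
move=> t0.
have qc c : (forall L, \sum_(r <= n < L) p r n t <= c) -> 1 <= c.
  move=> pc; rewrite -(cvg_lim _ q_sum_cvg)//.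
  apply: limr_le; first by apply/cvg_ex; eexists; exact: q_sum_cvg.
  apply: nearW => L.
  have cvL : \sum_(r <= n < L) p r n u @[u --> +oo] --> \sum_(r <= n < L) q n.
    by apply: cvg_sum_nat => n /andP[rn _]; exact: q_lim.
  rewrite -(cvg_lim _ cvL)//; apply: limr_le.
    by apply/cvg_ex; eexists; exact: cvL.
  near=> u.
  have tu : t <= u by [].
  have u0 : 0 <= u by exact: le_trans tu.
  have cvM : \sum_(r <= n < L) w M r n u @[M --> \oo] -->
      \sum_(r <= n < L) p r n u.
    by apply: cvg_sum_nat => n /andP[rn _]; exact: w_cvg.
  rewrite -(cvg_lim _ cvM)//; apply: limr_le.
    by apply/cvg_ex; eexists; exact: cvM.
  near=> M; apply: le_trans (pc M).
  apply: (@le_trans _ _ (\sum_(r <= n < M) w M r n u)).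
    have [Lr|rL] := leqP L r.
      rewrite big_geq// big_nat_cond sumr_ge0// => n /andP[/andP[rn _] _].
      exact: w_ge0.
    apply: sum_nat_sub_le => //; last first.
      by rewrite ltnW//=; near: M; exists L.
    by move=> n rn; exact: w_ge0.
  apply: le_trans
    (window_mass_nincr rate_ge0 rate_skip M (leqnn r) t0 tu) _ => //.
  by apply: ler_sum_nat => n /andP[rn _]; exact: w_le_p.
apply/nneseries_finP => [n rn|]; first exact: p_ge0.
apply/eqP; rewrite eq_le; apply/andP; split.
  by apply/nneseries_le_finP => [n rn|L]; [exact: p_ge0|exact: p_mass_le1].
case E : (\sum_(r <= n <oo) (p r n t)%:E)%E => [c| |].
- rewrite lee_fin; apply: qc; apply/nneseries_le_finP; last by rewrite E.
  by move=> n rn; exact: p_ge0.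
- by rewrite leey.
- have : (0 <= \sum_(r <= n <oo) (p r n t)%:E)%E.
    by apply: nneseries_ge0 => n rn _; rewrite lee_fin p_ge0.
  by rewrite E.
Unshelve. all: by end_near. Qed.

(** As p has mass 1 at time T, finitely many states carry more than 1 - e of it, and all large
    windows capture that much on these states. *)
Let loss_small T e : 0 <= T -> 0 < e -> \forall M \near \oo, F M M T < e.
Proof.
move=> T0 e0.
have /cvgr_gt /(_ (1 - e)) := p_mass T0.
rewrite gtrBl => /(_ e0) [L _ pL].
have cvM : \sum_(r <= n < L) w M r n T @[M --> \oo] -->
    \sum_(r <= n < L) p r n T.
  by apply: cvg_sum_nat => n /andP[rn _]; exact: w_cvg.
have /cvgr_gt /(_ _ (pL L (leqnn L))) wL := cvM.
near=> M; rewrite /F ltrBlDr -ltrBlDl.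
have wLM : 1 - e < \sum_(r <= n < L) w M r n T by near: M.
apply: lt_le_trans wLM _; have [Lr|rL] := leqP L r.
  rewrite big_geq// big_nat_cond sumr_ge0// => n /andP[/andP[rn _] _].
  exact: w_ge0.
apply: sum_nat_sub_le => //; last by rewrite ltnW//=; near: M; exists L.
by move=> n rn; exact: w_ge0.
Unshelve. all: by end_near. Qed.

Let loss_nondecr M s t : 0 <= s -> s <= t -> F M M s <= F M M t.
Proof.
by move=> s0 st; rewrite lerB// (window_mass_nincr rate_ge0 rate_skip).
Qed.

(** p dominates the window at each state and has total mass at most 1, so all the gaps in the window
    together are at most its lost mass. *)
Let gap_le_loss M m n t : (r <= m)%N -> (m <= n <= M)%N -> 0 <= t ->
  0 <= \sum_(m <= k < n) (p r k t - w M r k t) <= F M M t.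
Proof.
move=> rm mn t0.
have gap0 k : (r <= k)%N -> 0 <= p r k t - w M r k t.
  by move=> rk; rewrite subr_ge0 w_le_p.
apply/andP; split.
  rewrite big_nat_cond sumr_ge0// => k /andP[/andP[mk _] _].
  by rewrite gap0// (leq_trans rm).
apply: le_trans (sum_nat_sub_le gap0 rm mn) _.
by rewrite sumrB lerB// p_mass_le1.
Qed.

Let gap1_le_loss M n t : (r <= n)%N -> (n < M)%N -> 0 <= t ->
  0 <= p r n t - w M r n t <= F M M t.
Proof.
move=> rn nM t0; have := @gap_le_loss M n n.+1 t rn.
by rewrite big_nat1; apply; rewrite ?leqnSn.
Qed.

(** A complement rather than an infinite sum: for a possibly explosive chain it includes the mass at
    infinity, which [min_infty] places above every state. *)
Definition ccdf (u : nat -> R) (n : nat) : R := 1 - \sum_(r <= k < n) u k.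

Let tail_gap M n t : (r <= n <= M)%N -> 0 <= t ->
  0 <= F M n t - ccdf (p r ^~ t) n <= F M M t.
Proof.
move=> rnM t0; have -> : F M n t - ccdf (p r ^~ t) n =
    \sum_(r <= k < n) (p r k t - w M r k t).
  by rewrite sumrB /F /ccdf; ring.
exact: gap_le_loss.
Qed.

(** The formal derivative of the tail of p at n. It is only compared with the derivative in a
    window, so p itself is never differentiated. *)
Let flux n t := alpha n.-1 * p r n.-1 t - beta n * p r n t -
  xi * ccdf (p r ^~ t) n.

Let flux_window M n t : (r < n < M)%N -> 0 <= t ->
  `|(alpha n.-1 * (F M n.-1 t - F M n t) - beta n * (F M n t - F M n.+1 t) -
     xi * (F M n t - F M M t)) - flux n t| <=
  (alpha n.-1 + beta n + 2 * xi) * F M M t.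
Proof.
move=> /andP[rn nM] t0.
have rn1 := ltn_pred_leq rn.
have g1 : 0 <= p r n.-1 t - w M r n.-1 t <= F M M t.
  by apply: gap1_le_loss => //; lia.
have g2 := gap1_le_loss (ltnW rn) nM t0.
have g3 : 0 <= F M n t - ccdf (p r ^~ t) n <= F M M t.
  by apply: tail_gap => //; lia.
have := window_tailS alpha beta xi M t rn1; rewrite (ltn_predK rn) => ->.
have := window_tailS alpha beta xi M t (ltnW rn) => ->.
have a0 := alpha_ge0 rn1; have b0 := beta_ge0 rn.
rewrite /flux; set A := alpha _ in a0 *; set B := beta _ in b0 *.
set x1 := p r n.-1 t in g1 *; set x2 := p r n t in g2 *.
set x3 := ccdf _ _ in g3 *.
set y1 := w _ _ n.-1 _ in g1 *; set y2 := w _ _ n _ in g2 *.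
set y3 := F M n t in g3 *; set l := F M M t in g1 g2 g3 *.
move: g1 g2 g3 => /andP[g1 g1'] /andP[g2 g2'] /andP[g3 g3'].
have -> : A * y1 - B * y2 - xi * (y3 - l) - (A * x1 - B * x2 - xi * x3) =
  - (A * (x1 - y1)) + B * (x2 - y2) + (xi * l - xi * (y3 - x3)) by ring.
have h1 := ler_wpM2l a0 g1'; have h2 := ler_wpM2l b0 g2'.
have h3 := ler_wpM2l xi_ge0 g3'.
have k1 := mulr_ge0 a0 g1; have k2 := mulr_ge0 b0 g2.
have k3 := mulr_ge0 xi_ge0 g3.
have k4 : 0 <= xi * l by rewrite (le_trans k3).
have -> : (A + B + 2 * xi) * l = A * l + B * l + 2 * (xi * l) by ring.
by rewrite ler_norml; apply/andP; split; lra.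
Qed.

Let ccdf_p_cvg n : ccdf (p r ^~ t) n @[t --> +oo] --> ccdf q n.
Proof.
apply: cvgB; first exact: cvg_cst.
by apply: cvg_sum_nat => k /andP[rk _]; exact: q_lim.
Qed.

(* The forward equation of a window, integrated over [t, t+1] with both [t] and
   the window large. *)
Lemma steady_state n : (r < n)%N ->
  alpha n.-1 * q n.-1 - beta n * q n = xi * ccdf q n.
Proof.
move=> rn; have rn1 := ltn_pred_leq rn.
apply/eqP; rewrite -subr_eq0 -normr_le0; apply/ler_addgt0Pr => e e0.
rewrite add0r; set L := _ - _ : R.
have flux_cvg : flux n t @[t --> +oo] --> L.
  apply: cvgB; last by apply: cvgMl_tmp; exact: ccdf_p_cvg.
  by apply: cvgB; apply: cvgMl_tmp; apply: q_lim => //; exact: ltnW.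
(* The first three terms are the factor in [flux_window]. The 5 pays for five errors of at most d:
   the flux against its limit, and at each of the times t and t+1 the tail against its limit and the
   window against the tail. *)
pose K := alpha n.-1 + beta n + 2 * xi + 5.
have K0 : 0 < K.
  by have := alpha_ge0 rn1; have := beta_ge0 rn; rewrite /K; move: xi_ge0; lra.
have d0 : 0 < e / K by rewrite divr_gt0.
set d := e / K in d0.
have [t [t0 tL]] : exists t, 0 <= t /\ forall u, t <= u ->
    `|L - flux n u| < d /\ `|ccdf q n - ccdf (p r ^~ u) n| < d.
  have /cvgrPdist_lt/(_ _ d0) [A [_ AL]] := flux_cvg.
  have /cvgrPdist_lt/(_ _ d0) [B [_ BL]] := @ccdf_p_cvg n.
  exists (Num.max 0 (Num.max A B + 1)); split; first by rewrite le_max lexx.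
  move=> u; rewrite ge_max => /andP[_ ABu]; split.
    by apply: AL; apply: lt_le_trans ABu; rewrite ltr_pwDr// le_max lexx.
  by apply: BL; apply: lt_le_trans ABu; rewrite ltr_pwDr// le_max lexx orbT.
have tt1 : t < t + 1 by rewrite ltrDl.
have t10 : 0 <= t + 1 by rewrite addr_ge0.
have [M0 _ M0P] := loss_small t10 d0.
pose M := maxn M0 n.+1.
have rnM : (r < n < M)%N by rewrite rn leq_max ltnSn orbT.
have lossM : F M M (t + 1) < d by apply: M0P => /=; rewrite leq_maxl.
(* At t and t+1 the window tail is close to Q_n, so its derivative at the intermediate time c is
   small; that derivative is also close to the flux, hence to [L]. *)
have [|c] := @MVT _ (F M n) _ _ _ tt1
    (fun u _ => window_tail_is_derive alpha beta xi u rnM).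
  apply: continuous_subspaceT => u.
  exact: is_derive_cts (window_tail_is_derive alpha beta xi u rnM).
rewrite in_itv/= => /andP[tc ct1] Fc.
have c0 : 0 <= c by rewrite (le_trans t0)// ltW.
have fc := flux_window rnM c0.
have rnM' : (r <= n <= M)%N by case/andP: rnM => /ltnW-> /ltnW->.
have gt := tail_gap rnM' t0; have gt1 := tail_gap rnM' t10.
have lt := loss_nondecr M t0 (ltW tt1); have lc := loss_nondecr M c0 (ltW ct1).
have [_ qt] := tL t (lexx _); have [_ qt1] := tL _ (ltW tt1).
have [Lc _] := tL c (ltW tc).
move: Fc; rewrite (_ : t + 1 - t = 1) ?mulr1; last by ring.
move: fc; set V := _ - xi * (F M n c - F M M c) => fc Fc.
have K1 : 0 <= K - 5.
  by have := alpha_ge0 rn1; have := beta_ge0 rn; rewrite /K; move: xi_ge0; lra.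
have fcd : `|V - flux n c| <= (K - 5) * d.
  apply: le_trans fc _; rewrite /K addrK.
  by apply: ler_wpM2l; [rewrite /K addrK in K1|rewrite (le_trans lc)// ltW].
have -> : e = (K - 5) * d + 5 * d.
  by rewrite /d -mulrDl subrK mulrC divfK// gt_eqF.
move: fcd Lc qt qt1 gt gt1 lt lossM Fc.
rewrite !ler_norml !ltr_norml; move: ((K - 5) * d) => Kd.
move=> /andP[? ?] /andP[? ?] /andP[? ?] /andP[? ?] /andP[? ?] /andP[? ?] ? ? ?.
by apply/andP; split; lra.
Qed.

Let ccdf_q_ge0 n : 0 <= ccdf q n.
Proof.
rewrite subr_ge0; move: n; apply/nneseries_le_finP; last by rewrite q_sum.
by move=> n rn; exact: q_ge0.
Qed.

Let ccdfS (u : nat -> R) n : (r <= n)%N -> ccdf u n = ccdf u n.+1 + u n.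
Proof. by move=> rn; rewrite /ccdf big_nat_recr//=; ring. Qed.

Let ccdf_r (u : nat -> R) : ccdf u r = 1.
Proof. by rewrite /ccdf big_geq// subr0. Qed.

(** The starred rates divide by these tails. If Q_(n+1) = 0 then q_(n+1) = 0, and the steady-state
    equation at n+1 leaves alpha_n q_n = 0, so that Q_n = 0 too, against the induction
    hypothesis. *)
Let ccdf_q_gt0 n : (r <= n)%N -> 0 < ccdf q n.
Proof.
elim: n => [|n IHn]; first by rewrite leqn0 => /eqP <-; rewrite ccdf_r.
rewrite leq_eqVlt => /predU1P[<-|]; first by rewrite ccdf_r.
rewrite ltnS => rn; rewrite lt_neqAle ccdf_q_ge0 andbT eq_sym.
apply/negP => /eqP Q0.
have q0 : q n.+1 = 0.
  have := ccdfS q (leqW rn); have := ccdf_q_ge0 n.+2.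
  by have := q_ge0 (leqW rn); rewrite Q0; lra.
have := @steady_state n.+1 rn; rewrite Q0 q0 !mulr0 subr0 /= => /eqP.
rewrite mulf_eq0 gt_eqF ?alpha_gt0//= => /eqP qn0.
by have := IHn rn; rewrite ccdfS// Q0 qn0 addr0 ltxx.
Qed.

Lemma tail_ccdf n : (r <= n)%N -> tail q n = ccdf q n.
Proof.
move=> rn; apply: cvg_lim => //.
have cv : (fun L => \sum_(r <= k < L) q k - \sum_(r <= k < n) q k) @ \oo -->
    1 - \sum_(r <= k < n) q k.
  by apply: cvgB; [exact: q_sum_cvg|exact: cvg_cst].
apply: cvg_trans cv; apply: near_eq_cvg; near=> L.
have nL : (n <= L)%N by near: L; exists n.
by rewrite [X in X - _](big_cat_nat (n := n))//=; ring.
Unshelve. all: by end_near. Qed.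

Lemma ccdf_duality (pstar : nat -> nat -> R -> R) :
  chain_transitions r (birth_death_rate r (alpha_star alpha q)
    (beta_star beta q)) pstar ->
  forall n t, (r <= n)%N -> 0 <= t ->
  ccdf q n * ccdf (pstar r ^~ t) n = ccdf (p r ^~ t) n.
Proof.
move=> pstar_chain n t rn t0.
have [->|nr] := eqVneq n r; first by rewrite !ccdf_r mulr1.
have {nr} {}rn : (r < n)%N by rewrite ltn_neqAle eq_sym nr.
set as_ := alpha_star alpha q in pstar_chain.
set bs := beta_star beta q in pstar_chain.
have as_ge0 k : (r <= k)%N -> 0 <= as_ k.
  move=> rk; rewrite mulr_ge0 ?alpha_ge0// divr_ge0// tail_ccdf//.
  exact: leqW.
have bs_ge0 k : (r < k)%N -> 0 <= bs k.
  move=> rk; rewrite mulr_ge0 ?beta_ge0// divr_ge0// tail_ccdf//; last first.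
    exact: ltnW.
  by rewrite ltnW// ltnW.
have as_Q k : (r < k)%N -> as_ k.-1 * ccdf q k = alpha k.-1 * ccdf q k.-1.
  move=> rk; have rk1 : (r <= k.-1)%N by exact: ltn_pred_leq.
  rewrite /as_ /alpha_star (ltn_predK rk) !tail_ccdf//; last exact: ltnW.
  by rewrite mulrA divfK// gt_eqF// ccdf_q_gt0// ltnW.
have bs_Q k : (r < k)%N -> bs k * ccdf q k = beta k * ccdf q k.+1.
  move=> rk.
  rewrite /bs /beta_star !tail_ccdf//; [|exact: ltnW|exact/ltnW/ltnW].
  by rewrite mulrA divfK// gt_eqF// ccdf_q_gt0// ltnW.
(* From here on the starred rates enter only through their signs and the two product identities
   [as_Q] and [bs_Q]. *)
clearbody as_ bs.
pose G := window_tail r as_ bs 0.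
pose D M k u := ccdf q k * G M k u - F M k u.
have star_rate_ge0 i j : (r <= i)%N -> (r <= j)%N -> i != j ->
    0 <= birth_death_rate r as_ bs i j by exact: catastrophe_rate_ge0.
have star_rate_skip := @catastrophe_rate_skip R r as_ bs 0.
have G01 M k u : (k <= M)%N -> 0 <= u -> 0 <= G M k u <= 1.
  move=> kM u0; rewrite /G /window_tail; apply/andP; split; last first.
    rewrite gerBl big_nat_cond sumr_ge0// => l /andP[/andP[rl _] _].
    exact: (window_ge0 star_rate_ge0).
  rewrite subr_ge0; apply: le_trans
    (window_mass_le1 star_rate_ge0 star_rate_skip M (leqnn r) u0).
  have [kr|rk] := leqP k r.
    rewrite big_geq// big_nat_cond sumr_ge0// => l /andP[/andP[rl _] _].
    exact: (window_ge0 star_rate_ge0).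
  apply: sum_nat_sub_le => //; last by rewrite kM ltnW.
  by move=> l rl; exact: (window_ge0 star_rate_ge0).
have F_ge0 M u : 0 <= u -> 0 <= F M M u.
  move=> u0; rewrite subr_ge0.
  exact: (window_mass_le1 rate_ge0 rate_skip).
(* The source [F M M u] appears because the catastrophe term of F_k acts on F_k - F_M only, while
   the defect D is to satisfy the equation with the full tail. *)
pose dD M k u := alpha k.-1 * (D M k.-1 u - D M k u) -
  beta k * (D M k u - D M k.+1 u) - xi * (D M k u + F M M u).
have DdD M k (u : R) : (r < k < M)%N -> is_derive u 1 (D M k) (dD M k u).
  move=> rkM; have rk : (r < k)%N by case/andP: rkM.
  have dG : is_derive u 1 (G M k) (as_ k.-1 * (G M k.-1 u - G M k u) -
      bs k * (G M k u - G M k.+1 u)).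
    apply: (is_derive_eq (window_tail_is_derive as_ bs 0 u rkM)).
    by rewrite mul0r subr0.
  have dF := window_tail_is_derive alpha beta xi u rkM.
  apply: (is_derive_eq (is_deriveB (is_deriveZ (ccdf q k) dG) dF)).
  have := steady_state rk; rewrite [_ *: _]mulrBr !mulrA.
  rewrite [ccdf q k * as_ _]mulrC as_Q// [ccdf q k * bs _]mulrC bs_Q//.
  have Qk1 := ccdfS q (ltn_pred_leq rk); have Qk := ccdfS q (ltnW rk).
  rewrite (ltn_predK rk) in Qk1.
  rewrite /dD /D Qk1 Qk.
  move: (q k.-1) (q k) (ccdf q k.+1) => a b c.
  move: (G M k.-1 u) (G M k u) (G M k.+1 u) => x y z.
  move: (F M k.-1 u) (F M k u) (F M k.+1 u) (F M M u) => f1 f2 f3 f4.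
  move: (alpha k.-1) (beta k) => A B.
  clear; move=> E.
  (* The steady state at k, with b = q_k and c + b = Q_k, turns the surplus A a y into the missing
     death term B b y and catastrophe term xi Q_k y. *)
  have E' : A * a = B * b + xi * (c + b) by rewrite -E; ring.
  transitivity (A * (c + b) * (x - y) + (A * a) * (x - y)
    - B * c * (y - z) - (A * (f1 - f2) - B * (f2 - f3) - xi * (f2 - f4))).
    by ring.
  transitivity (A * ((c + b) * x - f1 - ((c + b) * y - f2)) + (A * a) * x
    - B * ((c + b) * y - f2 - (c * z - f3)) - xi * ((c + b) * y - f2 + f4)).
    by rewrite E'; ring.
  by ring.
(* The defect vanishes at r and at time 0, and at M it is Q_M G_M - F_M with 0 <= G_M <= 1; the
   maximum principle carries this bound inside. *)
have Dle M : (n < M)%N -> `|D M n t| <= ccdf q M + F M M t.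
  move=> nM; have tt : 0 <= t <= t by rewrite t0 lexx.
  have rnM : (r < n < M)%N by rewrite rn.
  have C0 : 0 <= ccdf q M + F M M t by rewrite addr_ge0 ?ccdf_q_ge0 ?F_ge0.
  have Dr u : D M r u = 0.
    by rewrite /D ccdf_r mul1r /G /window_tail !big_geq// subrr.
  have D0 k : (r < k < M)%N -> D M k 0 = 0.
    move=> /andP[rk kM]; suff w0 (q' : nat -> nat -> R) :
        \sum_(r <= l < k) window r q' M r l 0 = 1.
      by rewrite /D /G /window_tail !w0 subrr mulr0 subr0.
    rewrite -[RHS](@sum_nat_deltal R r k r (fun=> 1)) ?leqnn//.
    apply: eq_big_nat => l /andP[_ lk].
    by rewrite window0 ?mulr1// (ltn_trans _ kM).
  have FM u : 0 <= u <= t -> 0 <= F M M u <= F M M t.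
    by move=> /andP[u0 ut]; rewrite F_ge0//= loss_nondecr.
  have F_le u : 0 <= u <= t -> `|F M M u| <= ccdf q M + F M M t.
    move=> /FM /andP[Fu0 Fut]; rewrite ger0_norm// (le_trans Fut)// lerDr.
    exact: ccdf_q_ge0.
  apply: (birth_death_bound (a := fun k => alpha k.-1) (b := beta) (xi := xi)
    _ _ _ (DdD M) F_le _ _ _ rnM tt) => //.
  - by move=> k /andP[rk _]; rewrite alpha_ge0// ltn_pred_leq.
  - by move=> k /andP[rk _]; exact: beta_ge0.
  - by move=> u _; rewrite Dr normr0.
  - move=> u ut; have /andP[u0 _] := ut; have /andP[FMu FMt] := FM u ut.
    have /andP[GM0 GM1] := G01 M M u (leqnn _) u0.
    have Q0 := ccdf_q_ge0 M; have QG := mulr_ge0 Q0 GM0.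
    have QG1 := ler_wpM2l Q0 GM1; rewrite mulr1 in QG1.
    rewrite /D (le_trans (ler_normB _ _))// (ger0_norm QG) (ger0_norm FMu).
    exact: lerD.
  - by move=> k kM; rewrite D0// normr0.
have Dcvg : D M n t @[M --> \oo] -->
    ccdf q n * ccdf (pstar r ^~ t) n - ccdf (p r ^~ t) n.
  apply: cvgB.
    apply: cvgMl_tmp; apply: cvgB; first exact: cvg_cst.
    apply: cvg_sum_nat => k /andP[rk _].
    exact: (chain_transitions_window star_rate_ge0 star_rate_skip pstar_chain).
  apply: cvgB; first exact: cvg_cst.
  by apply: cvg_sum_nat => k /andP[rk _]; exact: w_cvg.
have Qcvg : ccdf q M @[M --> \oo] --> (0 : R).
  rewrite -[X in _ --> X](subrr (1 : R)).
  by apply: cvgB; [exact: cvg_cst|exact: q_sum_cvg].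
apply/eqP; rewrite -subr_eq0 -normr_le0; apply/ler_addgt0Pr => e e0.
rewrite add0r -(cvg_lim _ (cvg_norm Dcvg))//; apply: limr_le.
  by apply/cvg_ex; eexists; exact: cvg_norm Dcvg.
have e2 : 0 < e / 2 by rewrite divr_gt0.
near=> M; apply: (le_trans (Dle M _)); first by near: M; exists n.+1.
rewrite [e]splitr lerD// ltW//; near: M; last exact: loss_small.
exact: cvgr_lt Qcvg _ e2.
Unshelve. all: by end_near. Qed.

End duality.

(** * The minimum process *)

Section probability.
Variables (R : realType) (d : measure_display) (T : measurableType d).
Variable P : probability T R.

Lemma probability_setI1 (A B : set T) : measurable A -> measurable B ->
  P A = 1%E -> P (A `&` B) = P B.
Proof.
move=> mA mB PA; have PAC : P (~` A) = 0%E.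
  by rewrite probability_setC// PA subee.
have PBA : P (B `\` A) = 0%E.
  apply/eqP; rewrite eq_le measure_ge0 andbT -PAC le_measure ?inE//.
  - exact: measurableD.
  - exact: measurableC.
have -> : P B = (P (B `\` A) + P (B `&` A))%E by exact: measureDI.
by rewrite PBA add0e setIC.
Qed.

(** Events such as N >= n are reached by removing finitely many fibres, so only finite sums occur
    and the point at infinity needs no separate term. *)
Lemma probability_setD_fibers (A : set T) (F : nat -> set T) n :
  measurable A -> (forall k, measurable (F k)) -> trivIset setT F ->
  P (A `\` \bigcup_(k in `I_n) F k) =
  (P A - \sum_(0 <= k < n) P (A `&` F k))%E.
Proof.
move=> mA mF tF.
have mU : measurable (\bigcup_(k in `I_n) F k) by apply: bigcup_measurable.
rewrite measureD//; last by rewrite (le_lt_trans (probability_le1 P mA))// ltry.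
congr (_ - _)%E; rewrite setI_bigcupr bigcup_mkord big_mkord.
apply: (@measure_bigsetU _ _ _ P (fun k => A `&` F k)).
- by move=> k; exact: measurableI.
- exact: trivIset_setIl.
Qed.

End probability.

Unset Implicit Arguments.

Theorem theorem5p1 (R : realType) (r : nat) (alpha beta : nat -> R) (xi : R)
    (alpha_gt0 : forall n, (r <= n)%N -> 0 < alpha n)
    (beta_ge0 : forall n, (r.+1 <= n)%N -> 0 <= beta n)
    (xi_gt0 : 0 < xi)
    (p : nat -> nat -> R -> R)
    (p_chain : chain_transitions r (catastrophe_rate r alpha beta xi) p)
    (phat : nat -> nat -> R -> R)
    (phat_chain : chain_transitions r (birth_death_rate r alpha beta) phat)
    (phat_nonexplosive : forall j t, (r <= j)%N -> 0 <= t ->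
       (\sum_(r <= n <oo) (phat j n t)%:E = 1)%E)
    (q : nat -> R)
    (q_lim : forall j n, (r <= j)%N -> (r <= n)%N ->
       p j n t @[t --> +oo] --> q n)
    (q_sum : (\sum_(r <= n <oo) (q n)%:E = 1)%E)
    (d : measure_display) (T : measurableType d) (P : probability T R)
    (pstar : nat -> nat -> R -> R)
    (pstar_chain : chain_transitions r
       (birth_death_rate r (alpha_star alpha q) (beta_star beta q)) pstar)
    (Nstar : R -> T -> option nat)
    (Nstar_chain : markov_chain P r Nstar pstar)
    (Nstar0 : P [set w | Nstar 0 w = Some r] = 1%E)
    (N : {RV P >-> nat})
    (N_distr : forall n, (r <= n)%N -> P [set w | N w = n] = (q n)%:E)
    (N_indep : independent_of_process P Nstar N) :
  forall t n, 0 <= t -> (r <= n)%N ->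
    P [set w | min_infty (Nstar t w) (N w) = n] = (p r n t)%:E.
Proof.
move=> t n t0 rn.
have mX x : measurable [set w | Nstar t w = x].
  exact: (mc_measurable Nstar_chain).
have mN k : measurable [set w | N w = k].
  suff : measurable (N @^-1` [set k]) by [].
  exact: measurable_funPTI.
have X_distr k : (r <= k)%N ->
    P [set w | Nstar t w = Some k] = (pstar r k t)%:E.
  (* The Markov property with empty past, from time 0, where the chain is at r almost surely. *)
  move=> rk; have := @mc_markov _ _ _ _ _ _ _ Nstar_chain [::] r k 0 t.
  have -> : path_event Nstar [::] = setT by apply/seteqP; split=> // w _ e.
  rewrite setTI add0r Nstar0 mul1e probability_setI1//; last first.
    exact: (mc_measurable Nstar_chain).
  by apply.
have XN k m : P ([set w | Nstar t w = k] `&` [set w | N w = m]) =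
    (P [set w | Nstar t w = k] * P [set w | N w = m])%E.
  have := N_indep [:: (t, k)] m.
  have -> : path_event Nstar [:: (t, k)] = [set w | Nstar t w = k].
    apply/seteqP; split=> w /=; first by move=> /(_ _ (mem_head _ _)).
    by move=> Xw e; rewrite inE => /eqP ->.
  by apply=> e; rewrite inE => /eqP ->.
have X_lt k : (k < r)%N -> P [set w | Nstar t w = Some k] = 0%E.
  move=> kr; rewrite (_ : [set _ | _] = set0) ?measure0//; apply/seteqP.
  split=> // w /= Xw; have := mc_state Nstar_chain t0 Xw.
  by rewrite leqNgt kr.
have tN : trivIset setT (fun k => [set w | N w = k]).
  by apply/trivIsetP => i j _ _ /eqP ij; apply/seteqP; split=> // w [/= -> /ij].
have tX : trivIset setT (fun k => [set w | Nstar t w = Some k]).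
  apply/trivIsetP => i j _ _ /eqP ij; apply/seteqP; split=> // w [/= -> [/ij]].
  by [].
have q_ge0 k : (r <= k)%N -> 0 <= q k.
  by move=> rk; rewrite -lee_fin -N_distr.
pose v k := fine (P [set w | N w = k]).
have vE k : P [set w | N w = k] = (v k)%:E.
  by rewrite fineK// fin_num_measure.
have v_ge0 k : 0 <= v k by rewrite fine_ge0.
have v_q k : (r <= k)%N -> v k = q k by move=> rk; rewrite /v N_distr.
have v_le1 L : \sum_(0 <= k < L) v k <= 1.
  have := @probability_setD_fibers _ _ _ P setT _ L measurableT mN tN.
  rewrite probability_setT.
  under eq_bigr do rewrite setTI vE.
  rewrite sumEFin -EFinB => E.
  have : (0 <= P (setT `\` \bigcup_(k in `I_L) [set w | N w = k]))%E by [].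
  by rewrite E lee_fin subr_ge0.
(* The law of N is given on states from r on only; there it already has mass 1, so nothing is left
   below r. *)
have v_lt k : (k < r)%N -> v k = 0.
  move=> kr; have S0 : \sum_(0 <= k < r) v k <= 0.
    suff : 1 <= 1 - \sum_(0 <= k < r) v k by lra.
    rewrite -lee_fin -q_sum; apply/nneseries_le_finP => // L.
    rewrite lerBrDl; have [Lr|rL] := leqP L r.
      by rewrite (big_geq Lr) addr0.
    have := v_le1 L; rewrite (big_cat_nat (n := r))//=; last exact: ltnW.
    by congr (_ + _ <= _); apply: eq_big_nat => m /andP[/v_q].
  apply/eqP; rewrite eq_le v_ge0 andbT (le_trans _ S0)//.
  rewrite (bigD1_seq k) ?mem_index_iota ?iota_uniq//= lerDl.
  by apply: sumr_ge0.
have sum_v m : (r <= m)%N -> \sum_(0 <= k < m) v k = \sum_(r <= k < m) q k.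
  move=> rm; rewrite (big_cat_nat (n := r))//= big_nat_cond big1 ?add0r.
    by apply: eq_big_nat => k /andP[/v_q].
  by move=> k /andP[/andP[_ /v_lt]].
have sum_x m : (r <= m)%N ->
    (\sum_(0 <= k < m) P [set w | Nstar t w = Some k])%E =
    (\sum_(r <= k < m) pstar r k t)%:E.
  move=> rm; rewrite (big_cat_nat (n := r))//= big_nat_cond big1 ?add0e.
    by rewrite -sumEFin; apply: eq_big_nat => k /andP[/X_distr].
  by move=> k /andP[/andP[_ /X_lt]].
(* Split according to which variable attains the minimum n: [A] is the chain at n with N >= n, [B]
   is N = n with the chain strictly above n, possibly at infinity. Ties go to [A], hence the [n.+1]
   in [B]. *)
pose A := [set w | Nstar t w = Some n] `\`
  \bigcup_(k in `I_n) [set w | N w = k].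
pose B := [set w | N w = n] `\`
  \bigcup_(k in `I_n.+1) [set w | Nstar t w = Some k].
have -> : [set w | min_infty (Nstar t w) (N w) = n] = A `|` B.
  apply/seteqP; split=> w /=.
    rewrite /min_infty /A /B /=; case E : (Nstar t w) => [k|] /= H; last first.
      right; split=> //; by case=> k /= _; rewrite E.
    have [kn|kn] := eqVneq k n.
      left; split=> /=; first by rewrite kn.
      by case=> m /= mn Nm; move: H; rewrite Nm; lia.
    right; split=> /=; first by move: H kn; lia.
    by case=> m /= mn; rewrite E => -[km]; move: H kn mn; rewrite km; lia.
  case=> -[/= E nE].
    rewrite E /=; apply/minn_idPl; rewrite leqNgt; apply/negP => Nn.
    by apply: nE; exists (N w).
  rewrite /min_infty; case X : (Nstar t w) => [k|//]; rewrite E.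
  apply/minn_idPr; rewrite leqNgt; apply/negP => kn.
  by apply: nE; exists k => //=; exact: ltnW.
have mA : measurable A.
  by apply: measurableD => //; apply: bigcup_measurable.
have mB : measurable B.
  by apply: measurableD => //; apply: bigcup_measurable.
have -> : P (A `|` B) = (P A + P B)%E.
  apply: measureU => //; apply/seteqP; split=> // w [[/= E _] [/= _ nE]].
  by apply: nE; exists n => /=.
have -> : P A = (pstar r n t * ccdf r q n)%:E.
  rewrite probability_setD_fibers// X_distr//.
  under eq_bigr do rewrite XN vE X_distr// -EFinM.
  by rewrite sumEFin -mulr_sumr sum_v// -EFinB /ccdf mulrBr mulr1.
have -> : P B = (q n * ccdf r (pstar r ^~ t) n.+1)%:E.
  rewrite probability_setD_fibers// N_distr//.
  under eq_bigr do rewrite setIC XN N_distr// muleC.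
  rewrite -ge0_sume_distrr// sum_x; last exact: leqW.
  by rewrite -EFinM -EFinB /ccdf mulrBr mulr1.
have dual := ccdf_duality alpha_gt0 beta_ge0 xi_gt0 p_chain
  (fun m => q_lim r m (leqnn r)) q_sum pstar_chain.
have ccdfS (u : nat -> R) : u n = ccdf r u n - ccdf r u n.+1.
  by rewrite /ccdf big_nat_recr//=; ring.
(* With G the tail of the starred chain, (G_n - G_(n+1)) Q_n + (Q_n - Q_(n+1)) G_(n+1) telescopes to
   Q_n G_n - Q_(n+1) G_(n+1), which duality identifies with F_n - F_(n+1). *)
rewrite -EFinD (ccdfS (p r ^~ t)) -!dual ?(leqW rn)//.
rewrite {1}(ccdfS (pstar r ^~ t)) (ccdfS q); congr EFin; ring.
Qed.
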